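(* Suppose that $f\in\mathcal{P}^{p-1}(\mathcal{T}_0)$. Then, the vertex-based adaptive algorithm described in the context yields that $$\|\nabla(u-u_{\ell+1})\|_\Omega\le q_{\rm ctr}\,\|\nabla(u-u_\ell)\|_\Omega\quad\text{for all }\ell\in\mathbb{N}_0,\qquad q_{\rm ctr}:=\Big(1-\frac{\theta^2}{(d+1)^2C_{\rm lb}^2}\Big)^{1/2},$$ where the constant $C_{\rm lb}$ satisfies $C_{\rm lb}\le\max\{C_{\rm lb,max},C_{\rm lb,int}(p)\}$. If the condition $C_{\rm lb}^{\beta(\boldsymbol{a})}(\boldsymbol{a})\le C_{\rm lb,max}$ is satisfied for all marked vertices $\boldsymbol{a}\in\mathcal{M}_\ell$ and for all $\ell\in\mathbb{N}_0$, then the $p$-robust bound $C_{\rm lb}\le C_{\rm lb,max}$ holds true.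
   Context: Setting. $d\in\{2,3\}$, $\Omega\subset\mathbb{R}^d$ is a polygonal or polyhedral Lipschitz domain, $f\in L^2(\Omega)$, and $p\ge1$ is a fixed polynomial degree. $\langle\cdot,\cdot\rangle_\omega$ and $\|\cdot\|_\omega$ are the $L^2(\omega)$ (or $[L^2(\omega)]^d$) scalar product and norm. $u\in H_0^1(\Omega)$ is the solution of $\langle\nabla u,\nabla v\rangle_\Omega=\langle f,v\rangle_\Omega$ for all $v\in H_0^1(\Omega)$. Discretization. For a conforming triangulation $\mathcal{T}_\ell$ of $\Omega$ into compact triangles or tetrahedra with vertex set $\mathcal{V}_\ell$, $\mathcal{P}^p(\mathcal{T}_\ell)$ is the space of $\mathcal{T}_\ell$-piecewise polynomials of degree $p$, $\mathbb{V}_\ell:=\mathcal{P}^p(\mathcal{T}_\ell)\cap H_0^1(\Omega)$, and the Galerkin approximation $u_\ell\in\mathbb{V}_\ell$ satisfies $\langle\nabla u_\ell,\nabla v_\ell\rangle_\Omega=\langle f,v_\ell\rangle_\Omega$ for all $v_\ell\in\mathbb{V}_\ell$. $\Pi_\ell^p:L^2(\Omega)\to\mathcal{P}^p(\mathcal{T}_\ell)$ is the $L^2$-orthogonal projection. For $\boldsymbol{a}\in\mathcal{V}_\ell$, $\mathcal{T}_\ell(\boldsymbol{a}):=\{T\in\mathcal{T}_\ell:\boldsymbol{a}\in T\}$, $\omega_\ell(\boldsymbol{a})$ is the associated open subdomain, and $\psi_\ell^{\boldsymbol{a}}\in\mathcal{P}^1(\mathcal{T}_\ell)\cap H^1(\Omega)$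 is the hat function, equal to $1$ at $\boldsymbol{a}$ and $0$ at all other vertices. Local fluxes and estimator. If $\boldsymbol{a}\in\Omega$, $\boldsymbol{H}_0(\mathrm{div};\omega_\ell(\boldsymbol{a}))$ is the set of $\boldsymbol{\tau}\in\boldsymbol{H}(\mathrm{div};\omega_\ell(\boldsymbol{a}))$ with zero normal trace on $\partial\omega_\ell(\boldsymbol{a})$; if $\boldsymbol{a}\in\partial\Omega$, the normal trace is required to vanish only on $\partial\omega_\ell(\boldsymbol{a})\cap(\psi_\ell^{\boldsymbol{a}})^{-1}(\{0\})$. $\boldsymbol{RT}^p(\mathcal{S})$ is the space of (discontinuous) vector fields that on each $T\in\mathcal{S}$ belong to $[\mathcal{P}^p(T)]^d+\mathcal{P}^p(T)\boldsymbol{x}$. $\boldsymbol{\sigma}_\ell^{\boldsymbol{a}}$ is the minimizer of $\|\psi_\ell^{\boldsymbol{a}}\nabla u_\ell+\boldsymbol{\tau}_\ell\|_{\omega_\ell(\boldsymbol{a})}$ over all $\boldsymbol{\tau}_\ell\in\boldsymbol{RT}^p(\mathcal{T}_\ell(\boldsymbol{a}))\cap\boldsymbol{H}_0(\mathrm{div};\omega_\ell(\boldsymbol{a}))$ with $\nabla\cdot\boldsymbol{\tau}_\ell=\Pi_\ell^p(\psi_\ell^{\boldsymbol{a}}f)-\nabla\psi_\ell^{\boldsymbol{a}}\cdot\nabla u_\ell$. With $h_T:=\mathrm{diam}(T)$, the vertex indicators are $$\eta_\ell(\boldsymbol{a})^2:=\sum_{T\in\mathcal{T}_\ell(\boldsymbol{a})}\Big(\|\psi_\ell^{\boldsymbol{a}}\nabla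 u_\ell+\boldsymbol{\sigma}_\ell^{\boldsymbol{a}}\|_T+\tfrac{h_T}{\pi}\|\psi_\ell^{\boldsymbol{a}}f-\Pi_\ell^p(\psi_\ell^{\boldsymbol{a}}f)\|_T\Big)^2,$$ and $\eta_\ell(\mathcal{W}_\ell):=\big(\sum_{\boldsymbol{a}\in\mathcal{W}_\ell}\eta_\ell(\boldsymbol{a})^2\big)^{1/2}$ for $\mathcal{W}_\ell\subseteq\mathcal{V}_\ell$. Interior node property. For a vertex $\boldsymbol{a}\in\mathcal{V}_\ell$, a refinement has this property if interior nodes are created in all $T\in\mathcal{T}_\ell(\boldsymbol{a})$ as well as in all faces of $\mathcal{T}_\ell(\boldsymbol{a})$ that do not lie on $\partial\omega_\ell(\boldsymbol{a})$. Constant $C_{\rm lb,int}(p)$. For a conforming refinement $\mathcal{T}_{\ell+1}$ of $\mathcal{T}_\ell$, let $r_{\ell+1}^{\boldsymbol{a}}\in\mathbb{V}_{\ell+1}^{\boldsymbol{a}}:=\mathcal{P}^p(\mathcal{T}_{\ell+1})|_{\omega_\ell(\boldsymbol{a})}\cap H_0^1(\omega_\ell(\boldsymbol{a}))$ solve $\langle\nabla r_{\ell+1}^{\boldsymbol{a}},\nabla v_{\ell+1}\rangle_{\omega_\ell(\boldsymbol{a})}=\langle f,v_{\ell+1}\rangle_{\omega_\ell(\boldsymbol{a})}-\langle\nabla u_\ell,\nabla v_{\ell+1}\rangle_{\omega_\ell(\boldsymbol{a})}$ for all $v_{\ell+1}\in\mathbb{V}_{\ell+1}^{\boldsymbol{a}}$.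 $C_{\rm lb,int}(p)\in(0,\infty)$ is a (known to exist) constant depending only on $p$, $d$, and shape regularity of $\mathcal{T}_\ell$ and $\mathcal{T}_{\ell+1}$ such that, if $f\in\mathcal{P}^{p-1}(\mathcal{T}_\ell)$ and the interior node property holds for $\boldsymbol{a}$, then $\eta_\ell(\boldsymbol{a})\le C_{\rm lb,int}(p)\|\nabla r_{\ell+1}^{\boldsymbol{a}}\|_{\omega_\ell(\boldsymbol{a})}$. (All meshes obtained from $\mathcal{T}_0$ by newest-vertex bisection are uniformly shape-regular.) Algorithm. Convention: $x/0=\infty$ for $x>0$ and $0/0=0$. Mesh refinement is by newest-vertex bisection, for suitably chosen reference edges on $\mathcal{T}_0$. Input: conforming triangulation $\mathcal{T}_0$, Dörfler parameter $0<\theta\le1$, desired upper bound $C_{\rm lb,max}\in(0,\infty)$, and a maximal number $\beta_{\rm max}$ of newest-vertex bisections per refinement step that guarantees at least the interior node property, i.e., $\beta_{\rm max}\ge3$ for $d=2$ and $\beta_{\rm max}\ge6$ for $d=3$. For each $\ell=0,1,2,\dots$: (i) Compute $u_\ell\in\mathbb{V}_\ell$. (ii) Compute $\eta_\ell(\boldsymbol{a})$ for all $\boldsymbol{a}\in\mathcal{V}_\ell$. (iii) Determine a set $\mathcal{M}_\ell\subseteq\mathcal{V}_\ell$ of marked vertices of minimal cardinality with $\theta\,\eta_\ell(\mathcal{V}_\ell)\le\eta_\ell(\mathcal{M}_\ell)$. (iv) For each $\boldsymbol{a}\in\mathcal{M}_\ell$, set $\mathcal{T}_{\ell+1}^{\boldsymbol{a},0}:=\mathcal{T}_\ell(\boldsymbol{a})$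 and for $\beta=1,\dots,\beta_{\rm max}$: apply one newest-vertex bisection to all $T\in\mathcal{T}_{\ell+1}^{\boldsymbol{a},\beta-1}$ plus a minimal number of additional newest-vertex bisections to obtain a conforming triangulation $\mathcal{T}_{\ell+1}^{\boldsymbol{a},\beta}$; compute $r_{\ell+1}^{\boldsymbol{a},\beta}\in\mathbb{V}_{\ell+1}^{\boldsymbol{a},\beta}:=\mathcal{P}^p(\mathcal{T}_{\ell+1}^{\boldsymbol{a},\beta})\cap H_0^1(\omega_\ell(\boldsymbol{a}))$ with $\langle\nabla r_{\ell+1}^{\boldsymbol{a},\beta},\nabla v\rangle_{\omega_\ell(\boldsymbol{a})}=\langle f,v\rangle_{\omega_\ell(\boldsymbol{a})}-\langle\nabla u_\ell,\nabla v\rangle_{\omega_\ell(\boldsymbol{a})}$ for all $v\in\mathbb{V}_{\ell+1}^{\boldsymbol{a},\beta}$; stop the loop over $\beta$ and set $\beta(\boldsymbol{a}):=\beta$ if $\beta=\beta_{\rm max}$ or $C_{\rm lb}^\beta(\boldsymbol{a}):=\eta_\ell(\boldsymbol{a})/\|\nabla r_{\ell+1}^{\boldsymbol{a},\beta}\|_{\omega_\ell(\boldsymbol{a})}\le C_{\rm lb,max}$. (v) Employ a minimal number of newest-vertex bisections to obtain from $\mathcal{T}_\ell$ a conforming triangulation $\mathcal{T}_{\ell+1}$ whose restriction to $\omega_\ell(\boldsymbol{a})$ is equal to or finer than $\mathcal{T}_{\ell+1}^{\boldsymbol{a},\beta(\boldsymbol{a})}$ for all $\boldsymbol{a}\in\mathcal{M}_\ell$.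 *)

(* Defs.v *)
From HB Require Import structures.
From mathcomp Require Import all_boot all_order all_algebra finmap.
From mathcomp Require Import all_classical all_reals all_analysis.
From mathcomp Require mpoly.

Set Implicit Arguments.
Unset Strict Implicit.
Unset Printing Implicit Defensive.

Import Order.TTheory GRing.Theory Num.Theory.
Import numFieldNormedType.Exports.
Local Open Scope classical_set_scope.
Local Open Scope ring_scope.

(* Row vectors carry the product of the Borel sigma-algebras. *)
Section measurable_rV.
Variables (R : realType) (n : nat).
Let coord (i : 'I_n) (x : 'rV[R]_n) : measurableTypeR R := x 0 i.

Let rV_set0 : g_sigma_preimage coord set0.
Proof. exact: sigma_algebra0. Qed.
Let rV_setC A : g_sigma_preimage coord A -> g_sigma_preimage coord (~` A).
Proof. exact: sigma_algebraC. Qed.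
Let rV_bigcup (F : (set 'rV[R]_n)^nat) : (forall i, g_sigma_preimage coord (F i)) ->
  g_sigma_preimage coord (\bigcup_i (F i)).
Proof. exact: sigma_algebra_bigcup. Qed.

HB.instance Definition _ := @isMeasurable.Build
  (measure_tuple_display (R.-ocitv.-measurable).-sigma)
  'rV[R]_n (g_sigma_preimage coord) rV_set0 rV_setC rV_bigcup.

Lemma measurable_coord (i : 'I_n) :
  measurable_fun [set: 'rV[R]_n] (fun x => x 0 i : measurableTypeR R).
Proof.
move=> _ Y mY; rewrite setTI; apply: sub_sigma_algebra => /=.
rewrite -bigcup_seq/=; exists i => /=; first by rewrite mem_index_enum.
by exists Y => //; rewrite setTI.
Qed.

Lemma measurable_fun_rVP d (T : measurableType d) (f : T -> 'rV[R]_n) :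
  (forall i, measurable_fun [set: T] (fun t => f t 0 i : measurableTypeR R)) ->
  measurable_fun [set: T] f.
Proof.
move=> mf.
suff: g_sigma_preimage (fun i => coord i \o f) `<=` measurable.
  by rewrite g_sigma_preimage_comp => prefS _ A mA; apply: prefS; exists A.
apply: smallest_sub; first exact: sigma_algebra_measurable.
rewrite -bigcup_seq; apply: bigcup_sub => i _.
by move=> A [B mB <-]; exact: mf.
Qed.

End measurable_rV.


Section cons_rV.
Variables (R : realType) (n : nat).

Definition cons_rV (p : measurableTypeR R * 'rV[R]_n) : 'rV[R]_n.+1 :=
  \row_i oapp (p.2 0) p.1 (unlift ord0 i).

Definition uncons_rV (x : 'rV[R]_n.+1) : measurableTypeR R * 'rV[R]_n :=
  (x 0 ord0, \row_j x 0 (lift ord0 j)).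

Lemma cons_rVK : cancel cons_rV uncons_rV.
Proof.
move=> [a y]; rewrite /uncons_rV mxE unlift_none; congr pair.
by apply/rowP => j; rewrite !mxE liftK.
Qed.

Lemma measurable_cons_rV : measurable_fun [set: _ * _] cons_rV.
Proof.
apply: measurable_fun_rVP => i.
case: (unliftP ord0 i) => [j|] ->.
- rewrite (_ : (fun _ => _) = (fun x : 'rV[R]_n => x 0 j : measurableTypeR R) \o snd).
    by apply: measurableT_comp => //; exact: measurable_coord.
  by apply/funext => t; rewrite mxE liftK.
- rewrite (_ : (fun _ => _) = fst)//.
  by apply/funext => t; rewrite mxE unlift_none.
Qed.

Lemma measurable_uncons_rV : measurable_fun [set: 'rV[R]_n.+1] uncons_rV.
Proof.
apply: measurable_fun_pair; first exact: measurable_coord.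
apply: measurable_fun_rVP => i.
rewrite (_ : (fun _ => _) =
  (fun x : 'rV[R]_n.+1 => x 0 (lift ord0 i) : measurableTypeR R)).
  exact: measurable_coord.
by apply/funext => t; rewrite mxE.
Qed.

Variable mu : {sigma_finite_measure set 'rV[R]_n -> \bar R}.

Definition leb_cons : set 'rV[R]_n.+1 -> \bar R :=
  pushforward (@lebesgue_measure R \x mu)%E cons_rV.

Let leb_cons0 : leb_cons set0 = 0%E.
Proof. by rewrite /leb_cons /pushforward preimage_set0 measure0. Qed.

Let leb_cons_ge0 A : (0 <= leb_cons A)%E.
Proof. exact: (measure_ge0 (@lebesgue_measure R \x mu)%E). Qed.

Let leb_cons_sigma_additive : semi_sigma_additive leb_cons.
Proof.
pose mf := isMeasurableFun.Build _ _ _ _ _ measurable_cons_rV.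
pose F : {mfun _ >-> _} := HB.pack cons_rV mf.
exact: (@measure_semi_sigma_additive _ _ _
  (pushforward (@lebesgue_measure R \x mu)%E F)).
Qed.

HB.instance Definition _ := isMeasure.Build _ _ _ leb_cons
  leb_cons0 leb_cons_ge0 leb_cons_sigma_additive.

Let leb_cons_sigma_finite : sigma_finite setT leb_cons.
Proof.
have /sigma_finiteP[F [TF ndF Foo]] := sigma_finiteT (@lebesgue_measure R).
have /sigma_finiteP[G [TG ndG Goo]] := sigma_finiteT mu.
exists (fun k => uncons_rV @^-1` (F k `*` G k)).
  rewrite -preimage_bigcup [X in _ @^-1` X](_ : _ = setT) ?preimage_setT//.
  rewrite predeqE => -[x y]; split=> // _.
  have [k _ Fkx] : (\bigcup_i F i) x by rewrite -TF.
  have [l _ Gly] : (\bigcup_i G i) y by rewrite -TG.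
  exists (maxn k l) => //; split.
  - by move: x Fkx; exact/subsetPset/ndF/leq_maxl.
  - by move: y Gly; exact/subsetPset/ndG/leq_maxr.
move=> k; have [mF Fk] := Foo k; have [mG Gk] := Goo k; split.
  rewrite -[X in measurable X]setTI; apply: measurable_uncons_rV => //.
  exact: measurableX.
rewrite /leb_cons /pushforward -comp_preimage (_ : _ \o _ = id); last first.
  by apply/funext => x; exact: cons_rVK.
by rewrite preimage_id product_measure1E// lte_mul_pinfty// ge0_fin_numE.
Qed.

HB.instance Definition _ :=
  Measure_isSigmaFinite.Build _ _ _ leb_cons leb_cons_sigma_finite.

End cons_rV.

(* Lebesgue measure on R^n, as an iterated product of the one on R. *)
Fixpoint leb (R : realType) (n : nat) :
    {sigma_finite_measure set 'rV[R]_n -> \bar R} :=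
  match n with
  | 0 => \d_(0 : 'rV[R]_0)
  | m.+1 => leb_cons (leb R m)
  end.

Section euclidean.
Variables (R : realType) (d : nat).
Local Notation pt := 'rV[R]_d.
Implicit Types (x y z : pt) (D : set pt).

Definition dot x y : R := \sum_i x 0 i * y 0 i.

(* The library norm of 'rV[R]_d is the sup norm. *)
Definition enorm x : R := Num.sqrt (dot x x).

Definition diam D : R := sup [set enorm (xy.1 - xy.2) | xy in D `*` D].

Definition bdry D : set pt := closure D `\` D°.

(* Near each boundary point, D is the strict subgraph, in some direction e, of
   a Lipschitz function of the components orthogonal to e (that is, of a
   Lipschitz function on R^d that is invariant along e). *)
Definition lipschitz_boundary D : Prop :=
  forall x, bdry D x -> exists (e : pt) (g : pt -> R) (L r : R),
    [/\ enorm e = 1,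
        0 < r,
        forall y z, `|g y - g z| <= L * enorm (y - z),
        forall y t, g (y + t *: e) = g y &
        forall y, enorm (y - x) < r -> (D y <-> dot y e < g y)].

Definition lipschitz_domain D : Prop :=
  [/\ open D, D !=set0, connected D, bounded_set D & lipschitz_boundary D].

End euclidean.

Section function_spaces.
Variables (R : realType) (d : nat).
Local Notation pt := 'rV[R]_d.
Local Notation mu := (leb R d).
Implicit Types (D N : set pt) (v w phi : pt -> R) (g h tau : pt -> pt).

(* Functions are everywhere-defined representatives of their classes modulo
   null sets; only their values in the set under consideration matter. *)
Definition L2 D v : Prop :=
  measurable_fun D v /\ (\int[mu]_(x in D) ((v x) ^+ 2)%:E < +oo)%E.

Definition L2v D g : Prop := forall i, L2 D (fun x => g x 0 i).

Definition ip D v w : R := \int[mu]_(x in D) (v x * w x).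

Definition ipv D g h : R := \int[mu]_(x in D) dot (g x) (h x).

Definition nrm D v : R := Num.sqrt (ip D v v).

Definition nrmv D g : R := Num.sqrt (ipv D g g).

Definition partial (i : 'I_d) v : pt -> R := fun x => 'D_(delta_mx 0 i) v x.

Definition grad v : pt -> pt := fun x => \row_i partial i v x.

Fixpoint Ck (k : nat) v : Prop :=
  match k with
  | 0 => continuous v
  | m.+1 => continuous v /\
      forall i, (forall x, derivable v x (delta_mx 0 i)) /\ Ck m (partial i v)
  end.

(* C_c^oo(D) *)
Definition test_fun D phi : Prop :=
  [/\ forall k, Ck k phi,
      compact (closure [set x | phi x != 0]) &
      closure [set x | phi x != 0] `<=` D].

(* "v is in H^1_0(D), with weak gradient g": H^1_0(D) is the closure of
   C_c^oo(D) in the H^1 norm. *)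
Definition H10 D v g : Prop :=
  [/\ L2 D v, L2v D g &
      exists phi : nat -> pt -> R,
        [/\ forall n, test_fun D (phi n),
            (fun n => nrm D (phi n \- v)) @ \oo --> (0 : R) &
            (fun n => nrmv D (grad (phi n) \- g)) @ \oo --> (0 : R)]].

(* "tau is in H(div; D), with weak divergence delta and with zero normal trace
   on the part N of the boundary of D": the integration by parts formula has
   no boundary term for the smooth functions that vanish near the rest of the
   boundary. Test functions in C_c^oo(D) make delta the weak divergence. *)
Definition Hdiv0 D N tau (delta : pt -> R) : Prop :=
  [/\ L2v D tau, L2 D delta &
      forall phi, test_fun (~` closure (bdry D `\` N)) phi ->
        ipv D tau (grad phi) + ip D delta phi = 0].

End function_spaces.

Section meshes.
Variables (R : realType) (d : nat).
Local Notation pt := 'rV[R]_d.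

(* A simplex is the matrix of its vertices z_0, ..., z_d (the rows). It comes
   with a type in {0, ..., d-1}: the order of the vertices and the type encode
   the reference edge (always z_0 z_d) and those of all descendants. *)
Definition simplex : Type := ('M[R]_(d.+1, d) * 'I_d)%type.
HB.instance Definition _ := Choice.on simplex.

Definition mesh : Type := {fset simplex}.
Implicit Types (K : simplex) (T S : mesh) (a x : pt).

Definition vtx K (k : nat) : pt := row (inord k) K.1.

Definition verts K : {fset pt} := [fset row i K.1 | i : 'I_d.+1]%fset.

Definition vertices T : {fset pt} := (\bigcup_(K <- T) verts K)%fset.

Definition bary_weights (w : 'rV[R]_d.+1) : Prop :=
  (forall i, 0 <= w 0 i) /\ \sum_i w 0 i = 1.

Definition hull K : set pt :=
  [set x | exists2 w, bary_weights w & x = w *m K.1].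

(* the convex hull of the vertices of K that belong to V *)
Definition subhull K (V : {fset pt}) : set pt :=
  [set x | exists w, [/\ bary_weights w,
    forall i, w 0 i != 0 -> row i K.1 \in V & x = w *m K.1]].

(* the closed face of K opposite to its i-th vertex *)
Definition face K (i : 'I_d.+1) : set pt :=
  [set x | exists w, [/\ bary_weights w, w 0 i = 0 & x = w *m K.1]].

(* the relative interior of that face *)
Definition open_face K (i : 'I_d.+1) : set pt :=
  [set x | exists w, [/\ bary_weights w, w 0 i = 0,
    forall j, j != i -> 0 < w 0 j & x = w *m K.1]].

Definition nondegenerate K : Prop :=
  \det (row_mx (const_mx 1) K.1 : 'M[R]_(1 + d)) != 0.

Definition msupport T : set pt := [set x | exists2 K, K \in T & hull K x].

(* D stands for the closure of the triangulated domain. *)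
Definition triangulation T (D : set pt) : Prop :=
  [/\ forall K, K \in T -> nondegenerate K,
      forall K K', K \in T -> K' \in T -> K != K' ->
        (hull K)° `&` (hull K')° = set0 &
      msupport T = D].

Definition conforming T : Prop :=
  forall K K', K \in T -> K' \in T ->
    hull K `&` hull K' = subhull K (verts K').

(* Newest-vertex bisection in any dimension, as formulated by Stevenson (2008)
   after Maubach and Traxler: with m := (z_0 + z_d) / 2, the children of
   (z_0, ..., z_d) of type c are
     (z_0, m, z_1, ..., z_c, z_(c+1), ..., z_(d-1)) and
     (z_d, m, z_1, ..., z_c, z_(d-1), ..., z_(c+1)),
   both of type c + 1 modulo d. *)
Definition midpoint K : pt := 2^-1 *: (vtx K 0 + vtx K d).

Definition child1 K : simplex :=
  (\matrix_(i < d.+1) (if i == 0%N :> nat then vtx K 0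
                       else if i == 1%N :> nat then midpoint K
                       else vtx K i.-1),
   ordS K.2).

Definition child2 K : simplex :=
  (\matrix_(i < d.+1) (if i == 0%N :> nat then vtx K d
                       else if i == 1%N :> nat then midpoint K
                       else if (i <= K.2.+1)%N then vtx K i.-1
                       else vtx K (d + K.2 + 1 - i)),
   ordS K.2).

Definition bisect1 T S : Prop :=
  exists2 K, K \in T & S = ((T `\ K) `|` [fset child1 K; child2 K])%fset.

Fixpoint bisect (n : nat) T S : Prop :=
  if n is m.+1 then exists2 T', bisect1 T T' & bisect m T' S else S = T.

Definition bisect_all T : mesh :=
  ([fset child1 K | K in T] `|` [fset child2 K | K in T])%fset.

(* S arises from T by a minimal number of bisections such that it is conforming
   and satisfies P. *)
Definition min_bisect (P : mesh -> Prop) T S : Prop :=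
  exists n, [/\ bisect n T S, conforming S, P S &
    forall m S', bisect m T S' -> conforming S' -> P S' -> (n <= m)%N].

Definition patch T a : mesh := [fset K in T | a \in hull K]%fset.

Definition omega T a : set pt := (msupport (patch T a))°.

(* the elements of S inside the patch of a in T *)
Definition restr S T a : mesh :=
  [fset K in S | `[< (hull K `<=` msupport (patch T a))%classic >]]%fset.

Definition finer S T : Prop :=
  forall K, K \in S -> exists2 K', K' \in T & hull K `<=` hull K'.

Definition interior_node T S a : Prop :=
  forall K, K \in patch T a ->
    (exists2 z, z \in vertices S & (hull K)° z) /\
    (forall i, ~ (face K i `<=` bdry (omega T a)) ->
       exists2 z, z \in vertices S & open_face K i z).

End meshes.

(* The notations of mpoly clash with those of MathComp-Analysis. *)
Import -(notations) mpoly.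

Section discretization.
Variables (R : realType) (d : nat).
Local Notation pt := 'rV[R]_d.
Local Notation mu := (leb R d).
Local Notation mesh := (mesh R d).
Implicit Types (T S : mesh) (D : set pt) (a x : pt) (v w f r psi : pt -> R).
Implicit Types (g gu gr tau sigma : pt -> pt) (p n : nat) (q : mpoly d R).

Definition peval q x : R := meval (fun i => x 0 i) q.

Definition degle p q : Prop := (msize q <= p.+1)%N.

(* P^p(T): the values on the skeleton, a null set, are left unspecified. *)
Definition pw_poly p T v : Prop :=
  forall K, K \in T -> exists2 q, degle p q &
    forall x, (hull K)° x -> v x = peval q x.

(* "v is in P^p(T) and in H^1_0(D), with weak gradient g" *)
Definition fe_space p T D v g : Prop := pw_poly p T v /\ H10 D v g.

Definition weak_solution D f v g : Prop :=
  H10 D v g /\ forall w h, H10 D w h -> ipv D g h = ip D f w.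

Definition galerkin p T D f v g : Prop :=
  fe_space p T D v g /\
  forall w h, fe_space p T D w h -> ipv D g h = ip D f w.

(* the L^2(D)-orthogonal projection onto P^p(T) *)
Definition L2proj p T D f : pt -> R :=
  xget (fun=> 0) [set v | [/\ L2 D v, pw_poly p T v &
    forall w, L2 D w -> pw_poly p T w -> ip D (f \- v) w = 0]].

(* P^1(T) and H^1 is the space of continuous piecewise affine functions:
   a single-valued function that is affine on each compact simplex. *)
Definition hat T a : pt -> R :=
  xget (fun=> 0) [set psi | [/\
    forall K, K \in T -> exists2 q, degle 1 q &
      forall x, hull K x -> psi x = peval q x,
    psi a = 1 &
    forall b, b \in vertices T -> b != a -> psi b = 0]].

Definition RT p T tau : Prop :=
  forall K, K \in T -> exists (q : 'I_d -> mpoly d R) (s : mpoly d R),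
    [/\ forall i, degle p (q i), degle p s &
        forall x, (hull K)° x ->
          forall i, tau x 0 i = peval (q i) x + peval s x * x 0 i].

(* the part of the boundary of the patch where normal traces vanish *)
Definition noflux D T a : set pt :=
  [set x | bdry (omega T a) x /\ (D a \/ hat T a x = 0)].

(* the fluxes admissible at the vertex a; gu is the gradient of u_l *)
Definition flux_space p T D f gu a tau : Prop :=
  RT p (patch T a) tau /\
  exists2 delta, Hdiv0 (omega T a) (noflux D T a) tau delta &
    {ae mu, forall x, omega T a x ->
      delta x = L2proj p T D (hat T a \* f) x - dot (grad (hat T a) x) (gu x)}.

Definition local_misfit T gu a tau : pt -> pt :=
  fun x => hat T a x *: gu x + tau x.

Definition local_flux p T D f gu a sigma : Prop :=
  flux_space p T D f gu a sigma /\
  forall tau, flux_space p T D f gu a tau ->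
    nrmv (omega T a) (local_misfit T gu a sigma)
      <= nrmv (omega T a) (local_misfit T gu a tau).

(* Norms over a simplex are taken over its interior, which is contained in the
   open set where the functions live. *)
Definition eta p T D f gu sigma a : R :=
  Num.sqrt (\sum_(K <- patch T a)
    (nrmv (hull K)° (local_misfit T gu a sigma)
     + diam (hull K) / pi
       * nrm (hull K)° (hat T a \* f \- L2proj p T D (hat T a \* f))) ^+ 2).

Definition eta_set p T D f gu (sigma : pt -> pt -> pt) (W : {fset pt}) : R :=
  Num.sqrt (\sum_(a <- W) eta p T D f gu (sigma a) a ^+ 2).

(* Discrete residual lifting on the patch of a in T, with respect to the
   refinement S of this patch. *)
Definition residual p S T f gu a r gr : Prop :=
  fe_space p S (omega T a) r gr /\
  forall w h, fe_space p S (omega T a) w h ->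
    ipv (omega T a) gr h = ip (omega T a) f w - ipv (omega T a) gu h.

(* x / 0 = oo for x > 0, and 0 / 0 = 0 *)
Definition ratio (x y : R) : \bar R :=
  if y == 0 then (if x == 0 then 0%E else +oo%E) else (x / y)%:E.

End discretization.

Section algorithm.
Variables (R : realType) (d : nat).
Local Notation pt := 'rV[R]_d.

(* The quantities computed by the adaptive algorithm; l is the level, a a vertex
   of the mesh of this level, b the counter of the inner loop at a. *)
Record afem_run := AfemRun {
  Tm : nat -> mesh R d;                    (* T_l *)
  uh : nat -> pt -> R;                     (* u_l *)
  guh : nat -> pt -> pt;                   (* its gradient *)
  flux : nat -> pt -> pt -> pt;            (* sigma_l^a *)
  marked : nat -> {fset pt};               (* M_l *)
  locmesh : nat -> pt -> nat -> mesh R d;  (* T_(l+1)^(a,b) *)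
  res : nat -> pt -> nat -> pt -> R;       (* r_(l+1)^(a,b) *)
  gres : nat -> pt -> nat -> pt -> pt;     (* its gradient *)
  nbis : nat -> pt -> nat }.               (* b(a) *)

Variables (p : nat) (D : set pt) (f : pt -> R).
Variable A : afem_run.

Definition indicator (l : nat) (a : pt) : R :=
  eta p (Tm A l) D f (guh A l) (flux A l a) a.

Definition estimator (l : nat) (W : {fset pt}) : R :=
  eta_set p (Tm A l) D f (guh A l) (flux A l) W.

(* C_lb^b(a) *)
Definition lb_const (l : nat) (a : pt) (b : nat) : \bar R :=
  ratio (indicator l a) (nrmv (omega (Tm A l) a) (gres A l a b)).

Definition doerfler (theta : R) (l : nat) (M : {fset pt}) : Prop :=
  (M `<=` vertices (Tm A l))%fset /\
  theta * estimator l (vertices (Tm A l)) <= estimator l M.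

Definition marking_step (theta : R) (l : nat) : Prop :=
  doerfler theta l (marked A l) /\
  forall M, doerfler theta l M -> (#|` marked A l| <= #|` M|)%N.

(* the inner loop at the marked vertex a, which stops at b = nbis A l a *)
Definition inner_loop (Cmax : R) (bmax : nat) (l : nat) (a : pt) : Prop :=
  [/\ locmesh A l a 0 = patch (Tm A l) a,
      (1 <= nbis A l a <= bmax)%N,
      forall b, (b < nbis A l a)%N ->
        min_bisect (fun=> True) (bisect_all (locmesh A l a b))
          (locmesh A l a b.+1) /\
        residual p (locmesh A l a b.+1) (Tm A l) f (guh A l) a
          (res A l a b.+1) (gres A l a b.+1),
      forall b, (1 <= b < nbis A l a)%N -> ~ (lb_const l a b <= Cmax%:E)%E &
      nbis A l a = bmax \/ (lb_const l a (nbis A l a) <= Cmax%:E)%E].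

Definition refinement_step (l : nat) : Prop :=
  min_bisect (fun S => forall a, a \in marked A l ->
      finer (restr S (Tm A l) a) (locmesh A l a (nbis A l a)))
    (Tm A l) (Tm A l.+1).

Definition is_afem_run (T0 : mesh R d) (theta Cmax : R) (bmax : nat) : Prop :=
  Tm A 0 = T0 /\
  forall l, [/\
    galerkin p (Tm A l) D f (uh A l) (guh A l),
    forall a, a \in vertices (Tm A l) ->
      local_flux p (Tm A l) D f (guh A l) a (flux A l a),
    marking_step theta l,
    forall a, a \in marked A l -> inner_loop Cmax bmax l a &
    refinement_step l].

End algorithm.

(* Num.sqrt x = 0 for x < 0 *)
Definition q_ctr (R : realType) (d : nat) (theta C : R) : R :=
  Num.sqrt (1 - theta ^+ 2 / (d.+1%:R ^+ 2 * C ^+ 2)).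

(* Main.v *)
(* With f piecewise of degree p - 1, hat^a f is piecewise of degree p, so the
   projection in the flux constraint is the identity and the data oscillation
   vanishes. Since the hat functions form a partition of unity, the sum of the
   local fluxes has divergence f in Omega; by the Prager-Synge argument it
   controls the energy error, and as every simplex meets d + 1 patches,
   |grad (u - u_l)|^2 <= (d + 1) eta_l(V_l)^2. Conversely, the zero extension of
   a local lifting r^a lies in V_(l+1), whence its energy is the inner product
   of its gradient with grad (u_(l+1) - u_l), and the overlap argument bounds
   the sum of the energies by (d + 1) |grad (u_(l+1) - u_l)|^2. The Doerfler
   criterion and Pythagoras combine the two bounds.
   When the inner loop stops at bmax without reaching Cmax, the elements of the
   patch have been bisected uniformly bmax times; the midpoints of the
   successive bisections then include points in the interior of each simplex
   and of each of its faces, which remain vertices of T_(l+1) because a vertex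
   is an extreme point of the simplices containing it. *)

(* Piecewise polynomials are representatives whose values on the skeleton are unspecified.
   Identities between them are therefore proved on open simplices and hold almost everywhere, since
   faces lie in hyperplanes, which are null sets. A patch is the interior of a union of simplices
   contained in [closure Omega]. It could cross a slit of Omega, so Omega must equal the interior of
   its closure; the Lipschitz boundary guarantees this. The two constants [Cmax] and [Cint] are
   merged by choosing a lifting at each marked vertex separately: the one of the inner loop if it
   reached [Cmax], otherwise the one on the restriction of T_(l+1), to which [Cint] applies. Inside
   the patch, T_(l+1) refines the mesh of either lifting, so one overlap argument covers any mixture
   of them. Whether bisection creates interior nodes depends on the type of a simplex but not on its
   shape, so this is settled by a finite computation. *)
Require Import Defs.
From HB Require Import structures.
From mathcomp Require Import all_boot all_order all_algebra finmap.
From mathcomp Require Import all_classical all_reals all_analysis.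
From mathcomp Require Import measurable_realfun ring lra zify.
From mathcomp Require mpoly.

Set Implicit Arguments.
Unset Strict Implicit.
Unset Printing Implicit Defensive.
Import Order.TTheory GRing.Theory Num.Theory.
Import numFieldNormedType.Exports.
Local Open Scope classical_set_scope.
Local Open Scope ring_scope.

(* These names are shadowed by homonyms of the libraries. *)
Local Notation nondegenerate := Defs.nondegenerate.
Local Notation patch := Defs.patch.
Local Notation eta := Defs.eta.
Local Notation ratio := Defs.ratio.

(** * Lebesgue measure on row vectors *)

Section leb_theory.
Variables (R : realType).

Lemma measurable_coord_preimage n (i : 'I_n) (B : set (measurableTypeR R)) :
  measurable B -> measurable [set x : 'rV[R]_n | B (x 0 i)].
Proof. by move=> mB; rewrite -[X in measurable X]setTI; exact: measurable_coord. Qed.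

(** The sigma-algebra is generated by the coordinates. An open set for the sup norm is a countable
    union of boxes with rational centre and radius 1/(k+1), and a box is a finite intersection of
    coordinate preimages. *)
Lemma open_measurable_rV n (A : set 'rV[R]_n) : open A -> measurable A.
Proof.
move=> oA.
pose box (qk : 'rV[rat]_n * nat) : set 'rV[R]_n :=
  [set y | forall j, `|ratr (qk.1 0 j) - y 0 j| < qk.2.+1%:R^-1].
pose F qk := if `[< box qk `<=` A >] then box qk else set0.
have -> : A = \bigcup_qk F qk.
  rewrite eqEsubset; split => [x Ax|x [qk _]]; last first.
    by rewrite /F; case: asboolP => [h /h|].
  move: oA; rewrite openE => /(_ _ Ax)/nbhs_ballP[e /= e0 xeA].
  have [k ke] : exists k, k.+1%:R^-1 < e / 2.
    exists (Num.truncn (e / 2)^-1); rewrite invf_plt ?posrE ?divr_gt0 ?ltr0n//.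
    by rewrite Num.Theory.truncnS_gt.
  have k0 : 0 < k.+1%:R^-1 :> R by rewrite invr_gt0.
  have /(@choice _ _ _)[q xq] (j : 'I_n) : exists q : rat,
      `|ratr q - x 0 j| < k.+1%:R^-1.
    have /rat_in_itvoo[q /itvP qx] : x 0 j < x 0 j + k.+1%:R^-1 by rewrite ltrDl.
    exists q; rewrite ltr_distl qx andbT (lt_trans _ (_ : x 0 j < _)) ?qx//.
    by rewrite ltrBlDr ltrDl.
  exists (\row_j q j, k) => //; rewrite /F ifT; first by move=> j; rewrite mxE.
  apply/asboolP => y qy; apply: xeA; split => // i j; rewrite ord1.
  rewrite /ball/= (_ : x 0 j - y 0 j = (x 0 j - ratr (q j)) + (ratr (q j) - y 0 j)); last ring.
  rewrite (le_lt_trans (ler_normD _ _))// (splitr e) ltrD//.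
    by rewrite distrC (lt_trans (xq j)).
  by have /= := qy j; rewrite mxE => /lt_trans; apply.
apply: countable_bigcupT_measurable => // qk; rewrite /F; case: asboolP => // _.
rewrite (_ : box qk = \bigcap_(j in [set: 'I_n])
    [set y : 'rV[R]_n | ball (ratr (qk.1 0 j) : R) qk.2.+1%:R^-1 (y 0 j)]).
  apply: fin_bigcap_measurable => // j _.
  by apply: measurable_coord_preimage; exact: measurable_ball.
by rewrite eqEsubset; split => [y h j _|y h j]; [exact: h|exact: (h j)].
Qed.

Lemma closed_measurable_rV n (A : set 'rV[R]_n) : closed A -> measurable A.
Proof.
move=> cA; rewrite -(setCK A); apply: measurableC; apply: open_measurable_rV.
by rewrite openC.
Qed.

Lemma continuous_measurable_rV n (D : set 'rV[R]_n) (g : 'rV[R]_n -> R) :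
  measurable D -> continuous g -> measurable_fun D (g : _ -> measurableTypeR R).
Proof.
move=> mD cg; apply: (@measurable_funS _ _ _ _ setT) => //.
apply: (measurability _ (RGenOpens.measurableE R)) => _ [_ [a [b ->] <-]].
rewrite setTI; apply: open_measurable_rV; apply: open_comp => // x _.
Qed.

Definition hyperplane n (c : 'rV[R]_n) (b : R) : set 'rV[R]_n :=
  [set x | dot c x = b].

Lemma dot_continuous n (c : 'rV[R]_n) : continuous (dot c).
Proof.
rewrite (_ : dot c = fun x => \sum_i c 0 i * x 0 i); last exact/funext.
apply: continuous_big => [|i _ x]; first exact: add_continuous.
apply: (@cvgM _ _ (nbhs x) _ (cst (c 0 i)) (fun x : 'rV[R]_n => x 0 i)).
  exact: cvg_cst.
exact: coord_continuous.
Qed.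

Lemma measurable_hyperplane n (c : 'rV[R]_n) b : measurable (hyperplane c b).
Proof.
apply: closed_measurable_rV.
by have /continuous_closedP/(_ [set b]) := @dot_continuous _ c; apply; exact: closed_eq.
Qed.

Lemma lebS n (A : set 'rV[R]_n.+1) : leb R n.+1 A =
  (@lebesgue_measure R \x leb R n)%E (@cons_rV R n @^-1` A).
Proof. by []. Qed.

Lemma hyperplane_cons n (c : 'rV[R]_n.+1) b (a : R) (y : 'rV[R]_n) :
  hyperplane c b (cons_rV (a, y)) <->
  hyperplane (\row_j c 0 (lift ord0 j)) (b - c 0 ord0 * a) y.
Proof.
rewrite /hyperplane /= /dot big_ord_recl mxE unlift_none/=.
rewrite (eq_bigr (fun i => (\row_j c 0 (lift ord0 j)) 0 i * y 0 i)); last first.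
  by move=> i _; rewrite !mxE liftK.
by split => [<-|->]; ring.
Qed.

(** Induction with Fubini. If some coefficient beyond the first is nonzero, all slices are
    hyperplanes in one dimension less. Otherwise the first coordinate is confined to a single
    point. *)
Lemma leb_hyperplane n (c : 'rV[R]_n) b : c != 0 -> leb R n (hyperplane c b) = 0%E.
Proof.
elim: n c b => [c b|n IH c b c0]; first by rewrite (thinmx0 c) eqxx.
rewrite lebS; have [c'0|c'0] := eqVneq (\row_j c 0 (lift ord0 j)) 0; last first.
  apply: integral0_eq => a _ /=; rewrite -[RHS](IH _ (b - c 0 ord0 * a) c'0).
  congr (leb R n _); apply/seteqP; rewrite /xsection; split => y /=; rewrite inE => /hyperplane_cons//.
have c00 : c 0 ord0 != 0.
  apply: contra_neq c0 => c00; apply/rowP => i; rewrite mxE.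
  case: (unliftP ord0 i) => [j|] -> //.
  by move/rowP : c'0 => /(_ j); rewrite !mxE.
apply/eqP; rewrite -measure_le0.
rewrite (@le_trans _ _ ((@lebesgue_measure R \x leb R n)%E ([set b / c 0 ord0] `*` setT)))//.
  apply: le_measure; rewrite ?inE.
  - rewrite -[X in measurable X]setTI; apply: measurable_cons_rV => //.
    exact: measurable_hyperplane.
  - exact: measurableX.
  - move=> [a y] /hyperplane_cons; rewrite c'0 /hyperplane/= => h; split => //=.
    move: h; rewrite /dot big1 => [/eqP|i _]; last by rewrite mxE mul0r.
    by rewrite eq_sym subr_eq0 => /eqP ->; rewrite mulrAC divff// mul1r.
by rewrite product_measure1E//= lebesgue_measure_set1 mul0e.
Qed.

Definition cube n (M : R) : set 'rV[R]_n := [set x | forall i, `|x 0 i| <= M].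
Arguments cube : clear implicits.

Lemma measurable_cube n M : measurable (cube n M).
Proof.
rewrite (_ : cube n M = \bigcap_(j in [set: 'I_n])
    [set y : 'rV[R]_n | `[- M, M]%classic (y 0 j)]).
  by apply: fin_bigcap_measurable => // j _; exact: measurable_coord_preimage.
rewrite eqEsubset; split => [y h j _|y h j]; first by rewrite /= in_itv/= -ler_norml.
by have := h j I; rewrite /= in_itv/= -ler_norml.
Qed.

Lemma leb_cube n M : (leb R n (cube n M) < +oo)%E.
Proof.
elim: n => [|n IH]; first by rewrite /= diracE ltry.
rewrite lebS (@le_lt_trans _ _ ((@lebesgue_measure R \x leb R n)%E (`[- M, M]%classic `*` cube n M)))//.
  apply: le_measure; rewrite ?inE.
  - rewrite -[X in measurable X]setTI; apply: measurable_cons_rV => //.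
    exact: measurable_cube.
  - by apply: measurableX => //; exact: measurable_cube.
  - move=> [a y] h; split => /=.
      by have := h ord0; rewrite mxE unlift_none/= ler_norml in_itv.
    by move=> i; have := h (lift ord0 i); rewrite mxE liftK.
rewrite product_measure1E//=; last exact: measurable_cube.
rewrite lte_mul_pinfty// lebesgue_measure_itv/=; case: ifP => _ //.
Qed.

Lemma bounded_set_cube n (D : set 'rV[R]_n) : bounded_set D ->
  exists M, D `<=` cube n M.
Proof.
move=> [M [_ hM]]; exists (M + 1) => x Dx i.
apply: le_trans (hM (M + 1) _ x Dx); last by rewrite ltrDl.
by rewrite [leRHS]/Num.Def.normr /= mx_normrE; apply/bigmax_geP; right => /=; exists (0, i).
Qed.

Lemma leb_bounded n (D : set 'rV[R]_n) : measurable D -> bounded_set D ->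
  (leb R n D < +oo)%E.
Proof.
move=> mD /bounded_set_cube[M DM]; apply: le_lt_trans (leb_cube n M).
by apply: le_measure => //; rewrite inE//; exact: measurable_cube.
Qed.

End leb_theory.

(** * Barycentric coordinates and conforming meshes *)

Section barycentric.
Variables (R : realType) (d : nat).
Local Notation pt := 'rV[R]_d.
Implicit Types (K : simplex R d) (x a : pt).

Definition ext K : 'M[R]_(1 + d) := row_mx (const_mx 1) K.1.

Definition aug x : 'rV[R]_(1 + d) := row_mx (const_mx 1) x.

(** The barycentric coordinates of x, obtained by solving a linear system in which the column of
    ones encodes that they sum to 1. They are affine functions on the whole space, and K is cut out
    by their signs. *)
Definition lam K x : 'rV[R]_d.+1 := aug x *m invmx (ext K).

Lemma nondegenerateE K : nondegenerate K <-> ext K \in unitmx.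
Proof. by rewrite unitmxE unitfE. Qed.

Lemma mul_ext (w : 'rV[R]_d.+1) K : \sum_i w 0 i = 1 ->
  w *m ext K = aug (w *m K.1).
Proof.
move=> w1; rewrite /ext /aug mul_mx_row; congr row_mx.
apply/matrixP => i j; rewrite !mxE ord1 -[RHS]w1; apply: eq_bigr => k _.
by rewrite mxE mulr1.
Qed.

Lemma lamK K (w : 'rV[R]_d.+1) : nondegenerate K -> \sum_i w 0 i = 1 ->
  lam K (w *m K.1) = w.
Proof. by move=> /nondegenerateE nK w1; rewrite /lam -mul_ext// mulmxK. Qed.

Lemma lam_ext K x : nondegenerate K -> lam K x *m ext K = aug x.
Proof. by move=> /nondegenerateE nK; rewrite /lam mulmxKV. Qed.

Lemma lam_mul K x : nondegenerate K -> lam K x *m K.1 = x.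
Proof.
move=> nK; have := lam_ext x nK; rewrite /ext /aug mul_mx_row.
by move/eq_row_mx => [].
Qed.

Lemma sum_lam K x : nondegenerate K -> \sum_i lam K x 0 i = 1.
Proof.
move=> nK; have := lam_ext x nK; rewrite /ext /aug mul_mx_row.
move/eq_row_mx => [/matrixP/(_ 0 0) + _]; rewrite !mxE => <-.
by apply: eq_bigr => k _; rewrite [const_mx _ _ _]mxE mulr1.
Qed.

Lemma lam_affine K (I : finType) (v : I -> R) (y : I -> pt) i :
  \sum_k v k = 1 ->
  lam K (\sum_k v k *: y k) 0 i = \sum_k v k * lam K (y k) 0 i.
Proof.
move=> v1; rewrite /lam.
have -> : aug (\sum_k v k *: y k) = \sum_k v k *: aug (y k).
  rewrite /aug; 
  apply/rowP => j; rewrite summxE; case: (split_ordP j) => k ->.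
    rewrite row_mxEl mxE -[LHS]v1; apply: eq_bigr => l _.
    by rewrite mxE row_mxEl mxE mulr1.
  rewrite row_mxEr summxE; apply: eq_bigr => l _.
  by rewrite [in RHS]mxE row_mxEr mxE.
rewrite mulmx_suml summxE; apply: eq_bigr => k _.
by rewrite -scalemxAl mxE.
Qed.

Lemma mulmx_sum_rows K (w : 'rV[R]_d.+1) : w *m K.1 = \sum_k w 0 k *: row k K.1.
Proof. by rewrite mulmx_sum_row. Qed.

Lemma lam_row K k : nondegenerate K -> lam K (row k K.1) = delta_mx 0 k.
Proof.
move=> nK; rewrite rowE lamK// (bigD1 k)//= big1 ?mxE ?eqxx ?addr0// => j jk.
by rewrite mxE eqxx (negbTE jk).
Qed.

Lemma row_inj K i j : nondegenerate K -> row i K.1 = row j K.1 -> i = j.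
Proof.
move=> nK ij; have := lam_row i nK; rewrite ij lam_row//.
move=> /rowP/(_ i); rewrite !mxE !eqxx/=.
by case: (eqVneq i j) => // _ /eqP; rewrite eq_sym oner_eq0.
Qed.

Lemma hullP K x : nondegenerate K -> hull K x <-> forall i, 0 <= lam K x 0 i.
Proof.
move=> nK; split => [[w [w0 w1] ->]|h]; first by rewrite lamK.
by exists (lam K x); [split => //; exact: sum_lam|rewrite lam_mul].
Qed.

Lemma hull_ge0 K x i : nondegenerate K -> hull K x -> 0 <= lam K x 0 i.
Proof. by move=> nK /hullP; exact. Qed.

Lemma hull_sum K (I : finType) (v : I -> R) (y : I -> pt) :
  nondegenerate K -> (forall k, 0 <= v k) -> \sum_k v k = 1 ->
  (forall k, hull K (y k)) -> hull K (\sum_k v k *: y k).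
Proof.
move=> nK v0 v1 yK; apply/hullP => // i; rewrite lam_affine//.
by apply: sumr_ge0 => k _; rewrite mulr_ge0//; exact: hull_ge0.
Qed.

Lemma row_hull K i : nondegenerate K -> hull K (row i K.1).
Proof. by move=> nK; apply/hullP => // j; rewrite lam_row// mxE ler0n. Qed.

Lemma verts_hull K a : nondegenerate K -> a \in verts K -> hull K a.
Proof. by move=> nK /imfsetP[i _ ->]; exact: row_hull. Qed.

Lemma row_verts K i : row i K.1 \in verts K.
Proof. by apply/imfsetP; exists i. Qed.

Lemma lamE K x i : lam K x 0 i =
  invmx (ext K) 0 i + dot (\row_j invmx (ext K) (rshift 1 j) i) x.
Proof.
rewrite /lam mxE big_split_ord/= big_ord1 row_mxEl mxE mul1r; congr (_ + _).
  by congr (invmx _ _ _); apply/val_inj.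
by rewrite /dot; apply: eq_bigr => j _; rewrite row_mxEr mxE mulrC.
Qed.

Lemma lam_continuous K i : continuous (fun x => lam K x 0 i).
Proof.
move=> x; under eq_fun do rewrite lamE.
apply: (@cvgD _ _ _ (nbhs x) _ (cst (invmx (ext K) 0 i))); first exact: cvg_cst.
exact: dot_continuous.
Qed.

Definition open_simplex K : set pt := [set x | forall i, 0 < lam K x 0 i].

Lemma open_simplex_open K : open (open_simplex K).
Proof.
rewrite (_ : open_simplex K = \bigcap_(i in [set: 'I_d.+1])
    ((fun x => lam K x 0 i) @^-1` [set t | 0 < t])); last first.
  by apply/seteqP; split => [x h i _|x h i]; [exact: h|exact: (h i)].
rewrite -bigsetI_fset_set; last exact: finite_finset.
elim/big_ind : _ => [|A B|i _]; [exact: openT|exact: openI|].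
apply: open_comp => [x _|]; [exact: lam_continuous|exact: open_gt].
Qed.

Lemma hull_closed K : nondegenerate K -> closed (hull K).
Proof.
move=> nK; rewrite (_ : hull K = \bigcap_(i in [set: 'I_d.+1])
    ((fun x => lam K x 0 i) @^-1` [set t | 0 <= t])); last first.
  apply/seteqP; split => [x /hullP h i _|x h]; [exact: h|].
  by apply/hullP => // i; exact: (h i).
apply: closed_bigI => i _.
have /continuous_closedP/(_ [set t | 0 <= t]) := @lam_continuous K i; apply.
exact: closed_ge.
Qed.

Lemma open_simplex_hull K : nondegenerate K -> open_simplex K `<=` hull K.
Proof. by move=> nK x Kx; apply/hullP => // i; exact/ltW/Kx. Qed.

Lemma interior_hull K : nondegenerate K -> (hull K)° = open_simplex K.
Proof.
move=> nK; apply/seteqP; split; last first.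
  rewrite -[X in X `<=` _](interior_id _).1; last exact: open_simplex_open.
  exact/interiorS/open_simplex_hull.
move=> x iKx i; have := (hullP x nK).1 (interior_subset iKx) i.
rewrite le_eqVlt => /predU1P[/esym xi0|//]; exfalso.
(* Moving from x straight away from vertex i makes the i-th coordinate negative at once, although x
   is an interior point. *)
pose y (t : R) := x + t *: (x - row i K.1).
have cy : y t @[t --> (0:R)] --> y 0.
  apply: cvgD; first exact: cvg_cst.
  by apply: cvgZr_tmp; exact: cvg_id.
have : \forall t \near (0:R), hull K (y t).
  by apply: cy; rewrite /y scale0r addr0.
move=> /nbhs_ballP[e /= e0 eK].
have : hull K (y (e / 2)).
  by apply: eK; rewrite /ball/= sub0r normrN gtr0_norm; lra.
move=> /hullP-/(_ nK)/(_ i); rewrite /y.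
have -> : x + (e / 2) *: (x - row i K.1) =
    \sum_(b : bool) (if b then 1 + e / 2 else - (e / 2)) *: (if b then x else row i K.1).
  by rewrite big_bool/= scalerBr scalerDl scale1r scaleNr addrA.
rewrite lam_affine ?big_bool/=; last ring.
rewrite xi0 lam_row// mxE !eqxx mulr0 mulr1 add0r oppr_ge0; lra.
Qed.

Lemma lam_eq0_null K i : nondegenerate K -> (0 < d)%N ->
  leb R d [set x | lam K x 0 i = 0] = 0%E.
Proof.
move=> nK d0.
rewrite (_ : [set _ | _] =
  hyperplane (\row_j invmx (ext K) (rshift 1 j) i) (- invmx (ext K) 0 i)).
  apply: leb_hyperplane; apply/eqP => c0.
  (* A coordinate of zero slope would be constant, but it is 1 at vertex i and 0 at another vertex
     k. *)
  have [k ki] : exists k : 'I_d.+1, k != i.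
    have [->|?] := eqVneq i ord0; last by exists ord0; rewrite eq_sym.
    by exists (inord 1); apply/eqP => /(congr1 val); rewrite /= inordK.
  have := lam_row i nK; move=> /rowP/(_ i).
  have := lam_row k nK; move=> /rowP/(_ i).
  rewrite !lamE c0 !mxE !eqxx (eq_sym i k) (negbTE ki)/=.
  rewrite (_ : dot _ _ = 0); last by rewrite /dot big1// => j _; rewrite mxE mul0r.
  rewrite (_ : dot _ _ = 0); last by rewrite /dot big1// => j _; rewrite mxE mul0r.
  by move=> -> /eqP; rewrite eq_sym oner_eq0.
apply/seteqP; rewrite /hyperplane; split => x /=; rewrite lamE.
  by move/eqP; rewrite addrC addr_eq0 => /eqP.
by move=> ->; rewrite subrr.
Qed.

Lemma boundary_null K : nondegenerate K -> (0 < d)%N ->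
  (leb R d).-negligible (hull K `\` open_simplex K).
Proof.
move=> nK d0.
apply: (@negligibleS _ _ _ _ (\bigcup_(i in [set: 'I_d.+1]) [set x | lam K x 0 i = 0])).
  move=> x [/(hullP _ nK) xK]; rewrite /open_simplex/= => /existsNP[i /negP].
  by rewrite -leNgt => xi; exists i => //=; apply/eqP; rewrite eq_le xi xK.
rewrite -bigsetU_fset_set; last exact: finite_finset.
elim/big_ind : _ => [|A B|i _]; [exact: negligible_set0|exact: negligibleU|].
apply/negligibleP; last exact: lam_eq0_null.
apply: closed_measurable_rV.
have /continuous_closedP/(_ [set 0]) := @lam_continuous K i; apply.
exact: closed_eq.
Qed.

(** The barycentric coordinate that belongs to the point a, and 0 if a is not a vertex of K.
    Indexing by points instead of rows makes these functions comparable between simplices; they are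
    the local pieces of the hat function. *)
Definition wt K a x : R := \sum_(i | row i K.1 == a) lam K x 0 i.

Lemma wt_row K i x : nondegenerate K -> wt K (row i K.1) x = lam K x 0 i.
Proof.
move=> nK; rewrite /wt (bigD1 i)//= big1 ?addr0// => j /andP[/eqP ji].
by rewrite (row_inj nK ji) eqxx.
Qed.

Lemma wt_notin K a x : a \notin verts K -> wt K a x = 0.
Proof.
move=> aK; rewrite /wt big_pred0// => i; apply/negbTE.
by apply: contra aK => /eqP <-; exact: row_verts.
Qed.

Lemma card_verts K : nondegenerate K -> #|` verts K| = d.+1.
Proof.
move=> nK; rewrite card_imfset /=; last by move=> i j; exact: row_inj.
by rewrite -cardE card_ord.
Qed.

(* A vertex of K is an extreme point of K. *)
Lemma verts_subhull K K' a : nondegenerate K -> nondegenerate K' ->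
  hull K' `<=` hull K -> a \in verts K -> hull K' a -> a \in verts K'.
Proof.
move=> nK nK' K'K /imfsetP[i _ ->] [w [w0 w1]].
rewrite mulmx_sum_rows => ai.
have h k : lam K (row k K'.1) 0 i <= 1.
  have Kk : hull K (row k K'.1) by apply: K'K; exact: row_hull.
  rewrite -(sum_lam (row k K'.1) nK) (bigD1 i)//= lerDl sumr_ge0// => j _.
  exact: hull_ge0.
have : \sum_k w 0 k * (1 - lam K (row k K'.1) 0 i) = 0.
  under eq_bigr do rewrite mulrBr mulr1.
  by rewrite sumrB w1 -lam_affine// -ai lam_row// mxE !eqxx subrr.
move/eqP; rewrite psumr_eq0; last by move=> k _; rewrite mulr_ge0// subr_ge0.
move=> /allP/= hw.
have [k wk] : exists k, w 0 k != 0.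
  apply/existsP; rewrite -negb_forall; apply/negP => /forallP w00.
  by move: w1; rewrite big1 => [/esym/eqP|k _]; [rewrite oner_eq0|exact/eqP].
have := hw k (mem_index_enum k); rewrite mulf_eq0 (negbTE wk)/= subr_eq0 => /eqP/esym lk.
suff -> : row i K.1 = row k K'.1 by exact: row_verts.
rewrite -(lam_mul (row i K.1) nK) -(lam_mul (row k K'.1) nK); congr (_ *m _).
rewrite lam_row//; apply/rowP => j; rewrite mxE eqxx/= eq_sym.
have [<-|ji] := eqVneq i j; first by rewrite lk.
have Kk : hull K (row k K'.1) by apply: K'K; exact: row_hull.
have := sum_lam (row k K'.1) nK; rewrite (bigD1 i)//= lk -[X in _ = X]addr0.
move=> /addrI/eqP; rewrite psumr_eq0 => [/allP/(_ j (mem_index_enum j))|l _]; last exact: hull_ge0.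
by rewrite eq_sym ji => /eqP.
Qed.

Lemma verts_vertices (U : mesh R d) K a : K \in U -> a \in verts K -> a \in vertices U.
Proof. by move=> KU aK; apply/bigfcupP; exists K => //; rewrite KU. Qed.

End barycentric.

(** * Vertices and patches of a conforming mesh *)

Section mesh_geometry.
Variables (R : realType) (d : nat).
Local Notation pt := 'rV[R]_d.
Variable T : mesh R d.
Hypothesis nT : forall K, K \in T -> nondegenerate K.
Implicit Types (K : simplex R d) (x a : pt).

Lemma msupport_closed : closed (msupport T).
Proof.
rewrite (_ : msupport T = \bigcup_(K in [set` T]) hull K); last first.
  by apply/seteqP; split => x [K KT Kx]; exists K.
rewrite -bigsetU_fset_set; last exact: finite_fset.
rewrite big_seq; elim/big_ind : _ => [|A B|K KT]; [exact: closed0|exact: closedU|].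
by apply: hull_closed; apply: nT; move: KT; rewrite in_fset_set ?inE//; exact: finite_fset.
Qed.

Lemma ae_msupport : (0 < d)%N ->
  {ae leb R d, forall x, msupport T x -> exists2 K, K \in T & open_simplex K x}.
Proof.
move=> d0; apply: (@negligibleS _ _ _ _ (\bigcup_(K in [set` T]) (hull K `\` open_simplex K))).
  move=> x /= /not_implyP[[K KT Kx]] nx; exists K => //; split => // oKx.
  by apply: nx; exists K.
rewrite -bigsetU_fset_set; last exact: finite_fset.
rewrite big_seq; elim/big_ind : _ => [|A B|K KT]; [exact: negligible_set0|exact: negligibleU|].
by apply: boundary_null => //; apply: nT; move: KT; rewrite in_fset_set ?inE//; exact: finite_fset.
Qed.

Hypothesis cT : conforming T.

Lemma conf_vert K K' x i : K \in T -> K' \in T -> hull K x -> hull K' x ->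
  lam K x 0 i != 0 -> row i K.1 \in verts K'.
Proof.
move=> KT K'T Kx K'x; have : (hull K `&` hull K') x by [].
rewrite cT// => -[w [[w0 w1] h ->]]; rewrite lamK//; [exact: h|exact: nT].
Qed.

(** By conformity only the common vertices of K and K' carry weight at x, so the expansion of x in K
    is also its expansion in K'. This makes the glued hat function single-valued. *)
Lemma wt_conf K K' x a : K \in T -> K' \in T -> hull K x -> hull K' x ->
  wt K a x = wt K' a x.
Proof.
move=> KT K'T Kx K'x.
have [aK'|aK'] := boolP (a \in verts K'); last first.
  rewrite (wt_notin _ aK') /wt big1// => i /eqP ia; apply/eqP.
  by apply: contraNT aK' => li; rewrite -ia (conf_vert KT K'T Kx K'x).
have nK := nT KT; have nK' := nT K'T.
move/imfsetP : aK' => [j _ ->]; rewrite wt_row//.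
rewrite -[in RHS](lam_mul x nK) mulmx_sum_rows lam_affine ?sum_lam//.
rewrite /wt big_mkcond; apply: eq_bigr => i _.
have [->|li] := eqVneq (lam K x 0 i) 0; first by rewrite mul0r; case: ifP.
have /imfsetP[k _ ik] := conf_vert KT K'T Kx K'x li.
rewrite ik lam_row// [delta_mx _ _ _ _]mxE eqxx/=.
have [->|jk] := eqVneq j k; first by rewrite eqxx mulr1.
rewrite mulr0 ifF//; apply/eqP => /row_inj-/(_ nK')/esym/eqP.
by rewrite (negbTE jk).
Qed.

(** There are no hanging nodes: a has weight 1 at itself in the simplex it comes from, and
    conformity sends vertices of nonzero weight to vertices of K. *)
Lemma conf_vertex K a : K \in T -> a \in vertices T -> hull K a -> a \in verts K.
Proof.
move=> KT /bigfcupP[K' /andP[K'T _] aK'] Ka; have nK' := nT K'T.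
have K'a := verts_hull nK' aK'; move/imfsetP : aK' => [j _ aj].
rewrite aj; apply: (conf_vert K'T KT K'a Ka).
by rewrite aj lam_row// mxE !eqxx oner_eq0.
Qed.

(** At a point with positive coordinates, conformity puts every vertex of K into K', and both have d
    + 1 vertices. The conclusion concerns vertex sets because conformity does not separate two
    orderings of the same simplex. *)
Lemma open_verts K K' x : K \in T -> K' \in T -> open_simplex K x -> hull K' x ->
  verts K = verts K'.
Proof.
move=> KT K'T oKx K'x; have nK := nT KT; have nK' := nT K'T.
apply/eqP; rewrite eqEfcard !card_verts// leqnn andbT.
apply/fsubsetP => a /imfsetP[i _ ->].
apply: (conf_vert KT K'T _ K'x); first exact: open_simplex_hull.
by rewrite gt_eqF// oKx.
Qed.

Lemma in_patch K a : (K \in patch T a) = (K \in T) && (a \in hull K).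
Proof. by rewrite !inE. Qed.

Lemma patch_verts K a : a \in vertices T ->
  (K \in patch T a) = (K \in T) && (a \in verts K).
Proof.
move=> aT; rewrite in_patch; apply: andb_id2l => KT; apply/idP/idP.
  by rewrite inE => /conf_vertex; apply.
by rewrite inE; apply: verts_hull; exact: nT.
Qed.

Lemma open_patch_omega K a : K \in patch T a -> open_simplex K `<=` omega T a.
Proof.
move=> KTa; have KT : K \in T by move: KTa; rewrite in_patch => /andP[].
have nK := nT KT; rewrite -interior_hull//; apply: interiorS => x Kx.
by exists K.
Qed.

Lemma omega_open a : open (omega T a).
Proof. exact: open_interior. Qed.

Lemma omega_patch a x : omega T a x -> exists2 K, K \in patch T a & hull K x.
Proof. by move=> /interior_subset[K KT Kx]; exists K. Qed.

(** This is the source of the overlap constant d + 1: an open simplex meets only the patches of its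
    own vertices. *)
Lemma omega_open_simplex K a x : K \in T -> a \in vertices T ->
  open_simplex K x -> omega T a x -> a \in verts K.
Proof.
move=> KT aT oKx /omega_patch[K']; rewrite patch_verts// => /andP[K'T aK'] K'x.
by rewrite (open_verts KT K'T oKx K'x).
Qed.

End mesh_geometry.

(** * Newest-vertex bisection *)

Section bisection.
Variables (R : realType) (d : nat).
Local Notation pt := 'rV[R]_d.
Local Notation simplex := (simplex R d).
Local Notation mesh := (mesh R d).
Implicit Types (K C : simplex) (T S U : mesh) (x z a : pt).

Lemma aug_verts C a : a \in verts C -> (aug a <= ext C)%MS.
Proof.
move=> /imfsetP[i _ ->]; have -> : aug (row i C.1) = row i (ext C).
  by rewrite /ext row_row_mx row_const.
exact: row_sub.
Qed.

(* C stands for a child of K: its vertices include all the vertices of K but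
   the e-th one, and the midpoint of the edge from the e-th to the e'-th one *)
Section half.
Variables (K C : simplex) (e e' : 'I_d.+1).
Hypothesis ee' : e' != e.
Let m := 2^-1 *: (row e K.1 + row e' K.1).
Hypothesis mC : m \in verts C.
Hypothesis KC : forall i, i != e -> row i K.1 \in verts C.

(** The rows of [ext C] span those of [ext K]: only the vertex e is missing, and it is 2 m minus the
    vertex e'. *)
Lemma half_nondegenerate : nondegenerate K -> nondegenerate C.
Proof.
move=> /nondegenerateE nK; apply/nondegenerateE.
rewrite -row_full_unit -sub1mx; move: nK; rewrite -row_full_unit -sub1mx.
move/submx_trans; apply; apply/row_subP => i.
have -> : row i (ext K) = aug (row i K.1).
  by rewrite /ext row_row_mx row_const.
have [->|ie] := eqVneq i e; last exact/aug_verts/KC.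
have -> : aug (row e K.1) = 2 *: aug m - aug (row e' K.1).
  rewrite /aug scale_row_mx opp_row_mx add_row_mx; congr row_mx.
    by apply/matrixP => k l; rewrite !mxE; ring.
  by rewrite /m scalerA divff ?pnatr_eq0// scale1r addrK.
by apply: addmx_sub; [exact/scalemx_sub/aug_verts|rewrite eqmx_opp; exact/aug_verts/KC].
Qed.

(** The weight of vertex e is moved to the midpoint: together with an equal share of vertex e' it
    becomes twice that weight at m. What remains at e' is nonnegative by the assumed comparison. *)
Lemma half_hull x : nondegenerate K -> hull K x ->
  lam K x 0 e <= lam K x 0 e' -> hull C x.
Proof.
move=> nK Kx xee'; have nC := half_nondegenerate nK.
pose v i := if i == e then 2 * lam K x 0 e
            else if i == e' then lam K x 0 e' - lam K x 0 e else lam K x 0 i.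
pose y i := if i == e then m else row i K.1.
have -> : x = \sum_i v i *: y i.
  rewrite -[LHS](lam_mul x nK) mulmx_sum_rows (bigD1 e)//= (bigD1 e')//=.
  rewrite [RHS](bigD1 e)//= [in RHS](bigD1 e')//= /v /y !eqxx (negbTE ee') !addrA.
  congr (_ + _); last by apply: eq_bigr => i /andP[/negbTE -> /negbTE ->].
  rewrite /m scalerA mulrAC divff ?pnatr_eq0// mul1r scalerDr -addrA -scalerDl.
  by rewrite [X in _ = _ + X *: _]addrCA subrr addr0.
apply: hull_sum => // [i||i].
- rewrite /v; case: ifP => _; first by rewrite mulr_ge0// hull_ge0.
  by case: ifP => _; rewrite ?subr_ge0// hull_ge0.
- rewrite -[RHS](sum_lam x nK) (bigD1 e)//= (bigD1 e')//=.
  rewrite [RHS](bigD1 e)//= [in RHS](bigD1 e')//= /v !eqxx (negbTE ee') !addrA.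
  congr (_ + _); last by apply: eq_bigr => i /andP[/negbTE -> /negbTE ->].
  by ring.
- by rewrite /y; case: ifP => [_|/negbT ie]; apply: verts_hull => //; exact: KC.
Qed.

End half.

Lemma vtx_verts C k : vtx C k \in verts C.
Proof. exact: row_verts. Qed.

Lemma row_vtx C (i : 'I_d.+1) : row i C.1 = vtx C i.
Proof. by rewrite /vtx inord_val. Qed.

Lemma d_gt0 K : (0 < d)%N.
Proof. exact: leq_ltn_trans (leq0n _) (ltn_ord K.2). Qed.

Lemma vtx_child1 K k : (k <= d)%N -> vtx (child1 K) k =
  if k == 0%N then vtx K 0 else if k == 1%N then midpoint K else vtx K k.-1.
Proof. by move=> kd; rewrite {1}/vtx rowK inordK. Qed.

Lemma vtx_child2 K k : (k <= d)%N -> vtx (child2 K) k =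
  if k == 0%N then vtx K d else if k == 1%N then midpoint K
  else if (k <= K.2.+1)%N then vtx K k.-1 else vtx K (d + K.2 + 1 - k).
Proof. by move=> kd; rewrite {1}/vtx rowK inordK. Qed.

Lemma midpoint_child1 K : midpoint K \in verts (child1 K).
Proof. by have := vtx_verts (child1 K) 1; rewrite vtx_child1// (d_gt0 K). Qed.

Lemma midpoint_child2 K : midpoint K \in verts (child2 K).
Proof. by have := vtx_verts (child2 K) 1; rewrite vtx_child2// (d_gt0 K). Qed.

Lemma verts_child1 K i : i != ord_max -> row i K.1 \in verts (child1 K).
Proof.
rewrite row_vtx => id; have {id} : (i < d)%N.
  by have := ltn_ord i; rewrite ltnS leq_eqVlt => /predU1P[|//] h; case/eqP: id; exact/val_inj.
case: (nat_of_ord i) => [_|k kd].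
  by have := vtx_verts (child1 K) 0; rewrite vtx_child1.
by have := vtx_verts (child1 K) k.+2; rewrite vtx_child1.
Qed.

Lemma verts_child2 K i : i != ord0 -> row i K.1 \in verts (child2 K).
Proof.
rewrite row_vtx => i0; have {i0} : (0 < i)%N by rewrite lt0n.
have := ltn_ord i; have := ltn_ord K.2; rewrite ltnS; move: (nat_of_ord i) => k cd kd k0.
have [->|kd'] := eqVneq k d.
  by have := vtx_verts (child2 K) 0; rewrite vtx_child2.
have [kc|kc] := leqP k K.2.
  have := vtx_verts (child2 K) k.+1; rewrite vtx_child2; last lia.
  by rewrite ltnS kc eqSS (gtn_eqF k0).
have := vtx_verts (child2 K) (d + K.2 + 1 - k); rewrite vtx_child2; last lia.
rewrite !ifF; try lia.
by rewrite (_ : (_ - (_ - _))%N = k)//; lia.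
Qed.

Lemma ord0_max K : (ord0 : 'I_d.+1) != ord_max.
Proof. by rewrite -val_eqE /= eq_sym -lt0n (d_gt0 K). Qed.

Lemma midpointE K : midpoint K = 2^-1 *: (row ord0 K.1 + row ord_max K.1).
Proof. by rewrite !row_vtx. Qed.

Lemma midpointE' K : midpoint K = 2^-1 *: (row ord_max K.1 + row ord0 K.1).
Proof. by rewrite addrC midpointE. Qed.

Lemma child1_nondegenerate K : nondegenerate K -> nondegenerate (child1 K).
Proof.
apply: (@half_nondegenerate K _ ord_max ord0); first exact: (ord0_max K).
  by rewrite -midpointE' midpoint_child1.
exact: verts_child1.
Qed.

Lemma child2_nondegenerate K : nondegenerate K -> nondegenerate (child2 K).
Proof.
apply: (@half_nondegenerate K _ ord0 ord_max); first by rewrite eq_sym (ord0_max K).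
  by rewrite -midpointE midpoint_child2.
exact: verts_child2.
Qed.

Lemma hull_children K x : nondegenerate K -> hull K x ->
  hull (child1 K) x \/ hull (child2 K) x.
Proof.
move=> nK Kx; have [h|/ltW h] := leP (lam K x 0 ord_max) (lam K x 0 ord0).
  left; apply: (@half_hull K _ ord_max ord0) => //; first exact: (ord0_max K).
    by rewrite -midpointE' midpoint_child1.
  exact: verts_child1.
right; apply: (@half_hull K _ ord0 ord_max) => //; first by rewrite eq_sym (ord0_max K).
  by rewrite -midpointE midpoint_child2.
exact: verts_child2.
Qed.

Lemma midpoint_hull K : nondegenerate K -> hull K (midpoint K).
Proof.
move=> nK; have -> : midpoint K = \sum_(b : bool) 2^-1 *: (if b then vtx K 0 else vtx K d).
  by rewrite big_bool/= -scalerDr.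
by apply: hull_sum => // [|[]]; [rewrite big_bool/=; lra|exact: row_hull|exact: row_hull].
Qed.

Lemma hull_subset K C : nondegenerate K -> (forall i, hull K (row i C.1)) ->
  hull C `<=` hull K.
Proof.
by move=> nK CK _ [w [w0 w1] ->]; rewrite mulmx_sum_rows; exact: hull_sum.
Qed.

Lemma child1_hull K : nondegenerate K -> hull (child1 K) `<=` hull K.
Proof.
move=> nK; apply: hull_subset => // i; rewrite row_vtx vtx_child1 -1?ltnS//.
by do 2 (case: ifP => _; [by [exact: midpoint_hull|exact: row_hull]|]); exact: row_hull.
Qed.

Lemma child2_hull K : nondegenerate K -> hull (child2 K) `<=` hull K.
Proof.
move=> nK; apply: hull_subset => // i; rewrite row_vtx vtx_child2 -1?ltnS//.
by do 3 (case: ifP => _; [by [exact: midpoint_hull|exact: row_hull]|]); exact: row_hull.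
Qed.

(* K is covered by descendants of K in U that are all of generation >= n *)
Inductive dissected U : simplex -> nat -> Prop :=
| dissected0 K : K \in U -> dissected U K 0
| dissectedS K n : dissected U (child1 K) n.-1 -> dissected U (child2 K) n.-1 -> dissected U K n.

Lemma dissected_leq U K n m : (m <= n)%N -> dissected U K n -> dissected U K m.
Proof.
move=> + cK; elim: cK m => {K n} [K KU m|K n _ IH1 _ IH2 m mn].
  by rewrite leqn0 => /eqP ->; exact: dissected0.
by apply: dissectedS; [apply: IH1|apply: IH2]; lia.
Qed.

Lemma dissected_bisect1 U S K n : bisect1 U S -> dissected U K n -> dissected S K n.
Proof.
move=> [K0 K0U ->]; elim => {K n} [K KU|K n _ h1 _ h2]; last exact: dissectedS.
have [->|KK0] := eqVneq K K0.
  by apply: dissectedS; apply: dissected0; rewrite !inE eqxx ?orbT.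
by apply: dissected0; rewrite !inE KK0 KU.
Qed.

Lemma dissected_bisect k U S K n : bisect k U S -> dissected U K n -> dissected S K n.
Proof.
elim: k U => [U <-//|k IH U [U' UU' US] cU].
by apply: IH US _; exact: dissected_bisect1 cU.
Qed.

Lemma dissected_bisect_all U K n : dissected U K n -> dissected (bisect_all U) K n.+1.
Proof.
elim => {K n} [K KU|K n _ h1 _ h2]; apply: dissectedS => /=.
- by apply: dissected0; rewrite inE; apply/orP; left; apply/imfsetP; exists K.
- by apply: dissected0; rewrite inE; apply/orP; right; apply/imfsetP; exists K.
- by apply: dissected_leq h1; lia.
- by apply: dissected_leq h2; lia.
Qed.

Lemma dissected_hull U K n x : nondegenerate K -> dissected U K n -> hull K x ->
  exists K0, [/\ K0 \in U, hull K0 x & hull K0 `<=` hull K].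
Proof.
move=> + cK; elim: cK => {n K} [K KU nK Kx|K n _ h1 _ h2 nK Kx]; first by exists K; split.
have [Cx|Cx] := hull_children nK Kx.
- have [K0 [K0U K0x h]] := h1 (child1_nondegenerate nK) Cx.
  by exists K0; split => //; exact: subset_trans h (child1_hull nK).
- have [K0 [K0U K0x h]] := h2 (child2_nondegenerate nK) Cx.
  by exists K0; split => //; exact: subset_trans h (child2_hull nK).
Qed.

(** Bisection loses no vertex: the first child keeps all but the last one, and the second child
    keeps all but the first one. *)
Lemma dissected_vertices U K n a : dissected U K n -> a \in verts K -> a \in vertices U.
Proof.
move=> cK; elim: cK a => {n K} [K KU a|K n _ h1 _ h2 a /imfsetP[i _ ->]].
  exact: verts_vertices.
have [->|i0] := eqVneq i ord0; first exact/h1/verts_child1/(ord0_max K).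
exact/h2/verts_child2.
Qed.

Fixpoint midpoints n K : seq pt := if n is n'.+1 then
  midpoint K :: midpoints n' (child1 K) ++ midpoints n' (child2 K) else [::].

(** Each of these midpoints is a vertex of a child that is itself dissected, so it survives in U. *)
Lemma dissected_midpoints U K n : dissected U K n -> {subset midpoints n K <= vertices U}.
Proof.
elim => {n K} [//|K n c1 h1 _ h2 z]; case: n c1 h1 h2 => [//|n] /= c1 h1 h2.
rewrite inE mem_cat => /or3P[/eqP ->|/h1//|/h2//].
exact/(dissected_vertices c1)/midpoint_child1.
Qed.

Lemma bisect1_sub U S K : bisect1 U S -> (forall K, K \in U -> nondegenerate K) ->
  K \in S -> nondegenerate K /\ exists2 K', K' \in U & hull K `<=` hull K'.
Proof.
move=> [K0 K0U ->] nU; rewrite !inE => /orP[/andP[_ KU]|/orP[]/eqP->].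
- by split; [exact: nU|exists K].
- by split; [exact/child1_nondegenerate/nU|exists K0 => //; exact/child1_hull/nU].
- by split; [exact/child2_nondegenerate/nU|exists K0 => //; exact/child2_hull/nU].
Qed.

Lemma bisect_sub n U S : bisect n U S -> (forall K, K \in U -> nondegenerate K) ->
  (forall K, K \in S -> nondegenerate K) /\ finer S U.
Proof.
elim: n U => [U -> nU|n IH U [U' UU' U'S] nU]; first by split => // K KU; exists K.
have nU' K (KU' : K \in U') : nondegenerate K by have [] := bisect1_sub UU' nU KU'.
have [nS SU'] := IH _ U'S nU'; split => // K /SU'[K' K'U' KK'].
have [_ [K'' K''U h]] := bisect1_sub UU' nU K'U'.
by exists K'' => //; exact: subset_trans KK' h.
Qed.

Lemma bisect_all_nondegenerate U : (forall K, K \in U -> nondegenerate K) ->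
  forall K, K \in bisect_all U -> nondegenerate K.
Proof.
move=> nU K; rewrite inE => /orP[]/imfsetP[K0 /= K0U ->].
  exact/child1_nondegenerate/nU.
exact/child2_nondegenerate/nU.
Qed.

Lemma bisect_msupport n U S : bisect n U S -> (forall K, K \in U -> nondegenerate K) ->
  msupport S = msupport U.
Proof.
move=> US nU; have [nS SU] := bisect_sub US nU.
apply/seteqP; split => x [K KM Kx].
  by have [K' K'U KK'] := SU K KM; exists K' => //; exact: KK'.
have cK : dissected S K 0 by apply: dissected_bisect US _; exact: dissected0.
by have [K0 [K0S K0x _]] := dissected_hull (nU _ KM) cK Kx; exists K0.
Qed.

(* Whether a descendant's vertex is interior to K or to a face of K depends only
   on the support of its barycentric weights; the support of a midpoint is the
   union of those of the endpoints, which makes the search below computable. *)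
Definition has_supp K (s : bitseq) z : Prop := exists w : 'rV[R]_d.+1,
  [/\ bary_weights w, forall i, (0 < w 0 i) = nth false s i & z = w *m K.1].

Definition bor n (s t : bitseq) : bitseq :=
  mkseq (fun i => nth false s i || nth false t i) n.+1.

Lemma has_supp_mid K s t y z : has_supp K s y -> has_supp K t z ->
  has_supp K (bor d s t) (2^-1 *: (y + z)).
Proof.
move=> [v [[v0 v1] vs ->]] [w [[w0 w1] wt ->]]; exists (2^-1 *: (v + w)); split.
- split => [i|]; first by rewrite !mxE mulr_ge0// addr_ge0.
  under eq_bigr do rewrite !mxE; rewrite -mulr_sumr big_split/= v1 w1; lra.
- move=> i; rewrite !mxE nth_mkseq// -vs -wt pmulr_rgt0//.
  have := v0 i; have := w0 i; rewrite !le_eqVlt => /orP[/eqP<-|wi] /orP[/eqP<-|vi].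
  + by rewrite addr0 !ltxx.
  + by rewrite addr0 ltxx orbF.
  + by rewrite add0r ltxx.
  + by rewrite vi wi addr_gt0.
- by rewrite -scalemxAl mulmxDl.
Qed.

(* the supports of the vertices of a descendant of K, and its type *)
Definition ssimplex : Type := (seq bitseq * nat)%type.

Definition smid n (C : ssimplex) : bitseq := bor n (nth [::] C.1 0) (nth [::] C.1 n).

Definition schild1 n (C : ssimplex) : ssimplex :=
  (mkseq (fun i => if i == 0%N then nth [::] C.1 0
                   else if i == 1%N then smid n C else nth [::] C.1 i.-1) n.+1,
   C.2.+1 %% n)%N.

Definition schild2 n (C : ssimplex) : ssimplex :=
  (mkseq (fun i => if i == 0%N then nth [::] C.1 n
                   else if i == 1%N then smid n C
                   else if (i <= C.2.+1)%N then nth [::] C.1 i.-1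
                   else nth [::] C.1 (n + C.2 + 1 - i)) n.+1,
   C.2.+1 %% n)%N.

Fixpoint smidpoints n k (C : ssimplex) : seq bitseq := if k is k'.+1 then
  smid n C :: smidpoints n k' (schild1 n C) ++ smidpoints n k' (schild2 n C) else [::].

Definition has_supps K (M : ssimplex) C : Prop :=
  M.2 = C.2 /\ forall i, (i <= d)%N -> has_supp K (nth [::] M.1 i) (vtx C i).

Lemma has_supps_mid K M C : has_supps K M C -> has_supp K (smid d M) (midpoint C).
Proof. by move=> [_ h]; apply: has_supp_mid; exact: h. Qed.

Lemma has_supps_child1 K M C : has_supps K M C -> has_supps K (schild1 d M) (child1 C).
Proof.
move=> MC; have [c h] := MC; split => [/=|i id]; first by rewrite c.
rewrite vtx_child1// nth_mkseq//; case: ifP => _; first exact: h.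
case: ifP => _; first exact: has_supps_mid.
by apply: h; lia.
Qed.

Lemma has_supps_child2 K M C : has_supps K M C -> has_supps K (schild2 d M) (child2 C).
Proof.
move=> MC; have [c h] := MC; split => [/=|i id]; first by rewrite c.
rewrite vtx_child2// nth_mkseq//; case: ifP => _; first exact: h.
case: ifP => _; first exact: has_supps_mid.
by rewrite c; case: ifP => ic; apply: h; lia.
Qed.

Lemma smidpointsP K k M C s : has_supps K M C -> s \in smidpoints d k M ->
  exists2 z, z \in midpoints k C & has_supp K s z.
Proof.
elim: k M C => [//|k IH] M C MC /=; rewrite inE mem_cat => /or3P[/eqP->|ks|ks].
- by exists (midpoint C); [rewrite inE eqxx|exact: has_supps_mid].
- have [z zk Kz] := IH _ _ (has_supps_child1 MC) ks.
  by exists z => //; rewrite inE mem_cat zk orbT.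
- have [z zk Kz] := IH _ _ (has_supps_child2 MC) ks.
  by exists z => //; rewrite inE mem_cat zk !orbT.
Qed.

(** The starting point of the search: the support of the i-th vertex of K is the singleton of i. *)
Definition sroot n c : ssimplex := (mkseq (fun i => mkseq (pred1 i) n.+1) n.+1, c).

Lemma has_supps_root K : has_supps K (sroot d K.2) K.
Proof.
split => // i id; rewrite nth_mkseq//; exists (delta_mx 0 (inord i)); split.
- split => [j|]; first by rewrite mxE ler0n.
  by rewrite (bigD1 (inord i))//= big1 ?mxE ?eqxx ?addr0// => j ji; rewrite mxE (negbTE ji) andbF.
- move=> j; rewrite mxE nth_mkseq//= ltr0n lt0b ?eqxx/=.
  by rewrite -val_eqE/= inordK.
- by rewrite -rowE.
Qed.

(** A full support stands for a point in the interior of the simplex, and a support missing only i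
    for a point in the relative interior of the face opposite to i. All types c are tested because
    the elements of a mesh may have any of them. *)
Definition interior_supports n k := all (fun c =>
  let s := smidpoints n k (sroot n c) in
  (nseq n.+1 true \in s) &&
  all (fun i => mkseq (fun j => j != i) n.+1 \in s) (iota 0 n.+1)) (iota 0 n).

Lemma midpoints_open k K : interior_supports d k -> nondegenerate K ->
  exists2 z, z \in midpoints k K & open_simplex K z.
Proof.
move=> /allP/(_ K.2); rewrite mem_iota leq0n add0n ltn_ord => /(_ isT)/andP[+ _] nK.
move/(smidpointsP (has_supps_root K)) => [z zk [w [[w0 w1] ws zE]]].
exists z => // i; rewrite zE lamK//.
by rewrite ws nth_nseq ltn_ord.
Qed.

Lemma midpoints_open_face k K i : interior_supports d k -> nondegenerate K ->
  exists2 z, z \in midpoints k K & open_face K i z.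
Proof.
move=> /allP/(_ K.2); rewrite mem_iota leq0n add0n ltn_ord => /(_ isT)/andP[_ +] nK.
move=> /allP/(_ i); rewrite mem_iota leq0n add0n => /(_ (ltn_ord _)).
move/(smidpointsP (has_supps_root K)) => [z zk [w [[w0 w1] ws zE]]].
exists z => //; exists w; split => //.
  apply/eqP; rewrite eq_le w0 andbT leNgt ws nth_mkseq//.
  by rewrite eqxx.
by move=> j ji; rewrite ws nth_mkseq.
Qed.

(** Here and in the next lemma, 3 and 6 are the lower bounds imposed on the maximal number of
    bisections. Only booleans and natural numbers occur, so the check is by evaluation. *)
Lemma interior_supports2 : interior_supports 2 3.
Proof. by vm_compute. Qed.

Lemma interior_supports3 : interior_supports 3 6.
Proof. by vm_compute. Qed.

Lemma open_face_hull K i : open_face K i `<=` hull K.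
Proof. by move=> _ [w [w01 _ _ ->]]; exists w. Qed.

(* The element of S containing z lies in an element of U, which has z as a
   vertex and hence as an extreme point. *)
Lemma vertices_finer n T S U a K z :
  (forall K, K \in T -> nondegenerate K) -> bisect n T S ->
  (forall K, K \in U -> nondegenerate K) -> conforming U ->
  finer (restr S T a) U -> K \in patch T a -> hull K z ->
  z \in vertices U -> z \in vertices S.
Proof.
move=> nT TS nU cU fU KTa Kz zU.
have KT : K \in T by move: KTa; rewrite in_patch => /andP[].
have cK : dissected S K 0 by apply: dissected_bisect TS _; exact: dissected0.
have [K0 [K0S K0z K0K]] := dissected_hull (nT _ KT) cK Kz.
have K0r : K0 \in restr S T a.
  by rewrite !inE K0S/=; apply/asboolP => x /K0K Kx; exists K.
have [K' K'U K0K'] := fU _ K0r.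
apply: (verts_vertices K0S); apply: (verts_subhull (nU _ K'U) _ K0K' _ K0z).
  by have [nS _] := bisect_sub TS nT; exact: nS.
by apply: (conf_vertex nU cU K'U zU); exact: K0K'.
Qed.

(** U plays the role of the mesh reached by the inner loop at a, and S that of the next global mesh.
    Nodes are found in U by the search over supports and then transferred to S. *)
Lemma interior_nodes k n T S U a : interior_supports d k ->
  (forall K, K \in T -> nondegenerate K) -> bisect n T S ->
  (forall K, K \in U -> nondegenerate K) -> conforming U ->
  finer (restr S T a) U -> (forall K, K \in patch T a -> dissected U K k) ->
  interior_node T S a.
Proof.
move=> hk nT TS nU cU fU cU' K KTa.
have nK : nondegenerate K by apply: nT; move: KTa; rewrite in_patch => /andP[].
split => [|i _].
- have [z zk Kz] := midpoints_open hk nK.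
  exists z; last by rewrite interior_hull.
  apply: (vertices_finer nT TS nU cU fU KTa); first exact: open_simplex_hull.
  exact: (dissected_midpoints (cU' _ KTa)).
- have [z zk Kz] := midpoints_open_face i hk nK.
  exists z => //; apply: (vertices_finer nT TS nU cU fU KTa); first exact: open_face_hull Kz.
  exact: (dissected_midpoints (cU' _ KTa)).
Qed.

End bisection.

(** * Square-integrable functions *)

(** With the squared norm of v + t w as the quadratic, this is the Cauchy-Schwarz inequality. The
    case c = 0 must be covered, as w may have norm 0. *)
Lemma quadratic_ge0_discr (R : realFieldType) (a b c : R) : 0 <= c ->
  (forall t, 0 <= a + 2 * t * b + t ^+ 2 * c) -> b ^+ 2 <= a * c.
Proof.
rewrite le_eqVlt => /predU1P[<- h|c0 h].
  rewrite mulr0; have [->|b0] := eqVneq b 0; first by rewrite expr0n.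
  (* For c = 0 and b nonzero, this t gives the affine function the value -1. *)
  have := h (- (a + 1) / (2 * b)).
  by rewrite (_ : _ + _ = -1) ?oppr_ge0 ?ler10//; field; rewrite b0.
(* The minimizer of the quadratic. *)
have := h (- b / c); rewrite (_ : _ + _ = a - b ^+ 2 / c); last by field; rewrite gt_eqF.
by rewrite subr_ge0 ler_pdivrMr.
Qed.

(** A variance identity: the sum of the squares of n y_i - S equals n (n Q - S^2), and it is
    nonnegative. *)
Lemma sqr_sum_le (R : realFieldType) (I : Type) (s : seq I) (y : I -> R) :
  (\sum_(i <- s) y i) ^+ 2 <= (size s)%:R * \sum_(i <- s) y i ^+ 2.
Proof.
set S := \sum_(i <- s) y i; set Q := \sum_(i <- s) _; set n : R := (size s)%:R.
have [s0|n0] := posnP (size s).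
  by rewrite /S /n s0 (size0nil s0) big_nil expr0n mul0r.
have : 0 <= \sum_(i <- s) (n * y i - S) ^+ 2 by apply: sumr_ge0 => i _; exact: sqr_ge0.
have -> : \sum_(i <- s) (n * y i - S) ^+ 2 = n * (n * Q - S ^+ 2).
  transitivity (n ^+ 2 * Q - 2 * n * S * S + n * S ^+ 2); last by ring.
  have -> : n * S ^+ 2 = \sum_(i <- s) S ^+ 2.
    by rewrite big_const_seq count_predT iter_addr addr0 mulr_natl.
  have -> : 2 * n * S * S = \sum_(i <- s) 2 * n * S * y i by rewrite -mulr_sumr.
  rewrite /Q mulr_sumr -sumrB -big_split; apply: eq_bigr => i _ /=; ring.
by rewrite pmulr_rge0 ?ltr0n// subr_ge0.
Qed.
Section L2_theory.
Variables (R : realType) (d : nat).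
Local Notation pt := 'rV[R]_d.
Local Notation mu := (leb R d).
Implicit Types (D E : set pt) (u v w psi : pt -> R) (g h k : pt -> pt).

Lemma dotDl (x y z : pt) : dot (x + y) z = dot x z + dot y z.
Proof. by rewrite /dot -big_split; apply: eq_bigr => i _; rewrite mxE mulrDl. Qed.

Lemma dotC (x y : pt) : dot x y = dot y x.
Proof. by apply: eq_bigr => i _; rewrite mulrC. Qed.

Lemma dotZl a (x y : pt) : dot (a *: x) y = a * dot x y.
Proof. by rewrite /dot mulr_sumr; apply: eq_bigr => i _; rewrite mxE mulrA. Qed.

Lemma dot_ge0 (x : pt) : 0 <= dot x x.
Proof. by apply: sumr_ge0 => i _; rewrite -expr2 sqr_ge0. Qed.

Section fixed_domain.
Variable D : set pt.
Hypothesis mD : measurable D.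

Lemma L2_integrable_sqr v : L2 D v -> mu.-integrable D (fun x => (v x ^+ 2)%:E).
Proof.
move=> [mv v2]; apply/integrableP; split.
  by apply/measurable_EFinP; exact: measurable_funX.
by under eq_integral do rewrite gee0_abs ?lee_fin ?sqr_ge0//.
Qed.

Lemma L2_integrableM v w : L2 D v -> L2 D w ->
  mu.-integrable D (EFin \o (fun x => v x * w x)).
Proof.
move=> Lv Lw; have [mv _] := Lv; have [mw _] := Lw.
apply: (le_integrable mD _ _ (integrableD mD (L2_integrable_sqr Lv) (L2_integrable_sqr Lw))).
  by apply/measurable_EFinP; exact: measurable_funM.
move=> x _ /=; rewrite lee_fin [leRHS]ger0_norm; last by rewrite addr_ge0 ?sqr_ge0.
by rewrite ler_norml; apply/andP; split; nra.
Qed.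

Lemma L2P v : measurable_fun D v ->
  mu.-integrable D (fun x => (v x ^+ 2)%:E) -> L2 D v.
Proof.
move=> mv /integrableP[_ v2]; split => //; move: v2.
by under eq_integral do rewrite gee0_abs ?lee_fin ?sqr_ge0//.
Qed.

Lemma L2_ae_le v w : measurable_fun D v -> L2 D w ->
  (forall x, D x -> `|v x| <= `|w x|) -> L2 D v.
Proof.
move=> mv Lw vw; apply: L2P => //; apply: (le_integrable mD _ _ (L2_integrable_sqr Lw)).
  by apply/measurable_EFinP; exact: measurable_funX.
move=> x Dx /=; rewrite lee_fin !ger0_norm ?sqr_ge0//.
by rewrite -real_normK ?num_real// -[leRHS]real_normK ?num_real// lerXn2r ?nnegrE// vw.
Qed.

Lemma L2D v w : L2 D v -> L2 D w -> L2 D (v \+ w).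
Proof.
move=> Lv Lw; have [mv _] := Lv; have [mw _] := Lw.
apply: L2P; first exact: measurable_funD.
have -> : (fun x => ((v \+ w) x ^+ 2)%:E) =
    (fun x => (v x ^+ 2)%:E + (2 * (v x * w x))%:E + (w x ^+ 2)%:E)%E.
  by apply/funext => x; rewrite -!EFinD; congr EFin => /=; ring.
apply: integrableD => //; last exact: L2_integrable_sqr.
apply: integrableD => //; first exact: L2_integrable_sqr.
under eq_fun do rewrite EFinM.
by apply: integrableZl => //; exact: L2_integrableM.
Qed.

Lemma L2Z a v : L2 D v -> L2 D (fun x => a * v x).
Proof.
move=> Lv; have [mv _] := Lv; apply: L2P; first exact: measurable_funM.
under eq_fun do rewrite exprMn EFinM.
by apply: integrableZl => //; exact: L2_integrable_sqr.
Qed.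

Lemma L2_cst0 : L2 D (fun=> 0).
Proof. by split => //; rewrite integral0_eq// => x _; rewrite expr0n. Qed.

Lemma L2N v : L2 D v -> L2 D (\- v).
Proof.
move=> /(@L2Z (-1)); rewrite (_ : (fun _ => _) = \- v)//.
by apply/funext => x /=; rewrite mulN1r.
Qed.

Lemma L2B v w : L2 D v -> L2 D w -> L2 D (v \- w).
Proof. by move=> Lv Lw; exact/L2D/L2N. Qed.

Lemma L2_sum (I : Type) (s : seq I) (F : I -> pt -> R) : (forall i, L2 D (F i)) ->
  L2 D (fun x => \sum_(i <- s) F i x).
Proof.
move=> LF; elim: s => [|i s IH].
  by under eq_fun do rewrite big_nil; exact: L2_cst0.
by under eq_fun do rewrite big_cons; exact: L2D.
Qed.

Lemma L2_bounded_mul psi v : measurable_fun D psi -> (forall x, D x -> `|psi x| <= 1) ->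
  L2 D v -> L2 D (psi \* v).
Proof.
move=> mpsi psi1 Lv; have [mv _] := Lv; apply: (L2_ae_le _ Lv); first exact: measurable_funM.
by move=> x Dx /=; rewrite normrM ler_piMl// psi1.
Qed.

Lemma ipC v w : ip D v w = ip D w v.
Proof. by apply: eq_Rintegral => x _; rewrite mulrC. Qed.

Lemma ipDl u v w : L2 D u -> L2 D v -> L2 D w -> ip D (u \+ v) w = ip D u w + ip D v w.
Proof.
move=> Lu Lv Lw; rewrite /ip -RintegralD//; [|exact: L2_integrableM..].
by apply: eq_Rintegral => x _ /=; rewrite mulrDl.
Qed.

Lemma ipZl a v w : L2 D v -> L2 D w -> ip D (fun x => a * v x) w = a * ip D v w.
Proof.
move=> Lv Lw; rewrite /ip -RintegralZl//; last exact: L2_integrableM.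
by apply: eq_Rintegral => x _ /=; rewrite mulrA.
Qed.

Lemma ipDr u v w : L2 D u -> L2 D v -> L2 D w -> ip D w (u \+ v) = ip D w u + ip D w v.
Proof. by move=> Lu Lv Lw; rewrite !(ipC w) ipDl. Qed.

Lemma ipZr a v w : L2 D v -> L2 D w -> ip D w (fun x => a * v x) = a * ip D w v.
Proof. by move=> Lv Lw; rewrite !(ipC w) ipZl. Qed.

Lemma ipNl v w : L2 D v -> L2 D w -> ip D (\- v) w = - ip D v w.
Proof.
move=> Lv Lw; rewrite -mulN1r -ipZl//; congr ip.
by apply/funext => x /=; rewrite mulN1r.
Qed.

Lemma ipBl u v w : L2 D u -> L2 D v -> L2 D w -> ip D (u \- v) w = ip D u w - ip D v w.
Proof. by move=> Lu Lv Lw; rewrite -ipNl// -ipDl//; exact: L2N. Qed.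

Lemma ip_ge0 v : 0 <= ip D v v.
Proof. by apply: Rintegral_ge0 => x _; rewrite -expr2 sqr_ge0. Qed.

Lemma nrm_ge0 v : 0 <= nrm D v.
Proof. exact: sqrtr_ge0. Qed.

Lemma nrmE v : nrm D v ^+ 2 = ip D v v.
Proof. by rewrite sqr_sqrtr// ip_ge0. Qed.

Lemma ip_CS v w : L2 D v -> L2 D w -> `|ip D v w| <= nrm D v * nrm D w.
Proof.
move=> Lv Lw; rewrite -(@ler_pXn2r _ 2) ?nnegrE ?mulr_ge0 ?nrm_ge0//.
rewrite real_normK ?num_real// exprMn !nrmE; apply: quadratic_ge0_discr; first exact: ip_ge0.
move=> t; have Ltw := L2Z t Lw; have := ip_ge0 (v \+ (fun x => t * w x)).
rewrite ipDl ?(ipDr _ _ Lv) ?(ipDr _ _ Ltw)//; last exact: L2D.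
by rewrite !ipZl// !ipZr// (ipC w v); congr (_ <= _); ring.
Qed.

Lemma L2vD g h : L2v D g -> L2v D h -> L2v D (g \+ h).
Proof.
move=> Lg Lh i; have := L2D (Lg i) (Lh i); congr L2.
by apply/funext => x; rewrite /= mxE.
Qed.

Lemma L2vZ a g : L2v D g -> L2v D (fun x => a *: g x).
Proof.
move=> Lg i; have := L2Z a (Lg i); congr L2.
by apply/funext => x; rewrite /= mxE.
Qed.

Lemma L2vN g : L2v D g -> L2v D (\- g).
Proof.
move=> Lg i; have := L2N (Lg i); congr L2.
by apply/funext => x; rewrite /= mxE.
Qed.

Lemma L2vB g h : L2v D g -> L2v D h -> L2v D (g \- h).
Proof. by move=> Lg Lh; exact/L2vD/L2vN. Qed.

Lemma L2v_cst0 : L2v D (fun=> 0).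
Proof.
move=> i; have := L2_cst0; congr L2.
by apply/funext => x; rewrite mxE.
Qed.

Lemma L2v_sum (I : Type) (s : seq I) (F : I -> pt -> pt) : (forall i, L2v D (F i)) ->
  L2v D (fun x => \sum_(i <- s) F i x).
Proof.
move=> LF j; have := L2_sum s (fun i => LF i j); congr L2.
by apply/funext => x; rewrite summxE.
Qed.

Lemma L2v_bounded_scale psi g : measurable_fun D psi -> (forall x, D x -> `|psi x| <= 1) ->
  L2v D g -> L2v D (fun x => psi x *: g x).
Proof.
move=> mpsi psi1 Lg i; have := L2_bounded_mul mpsi psi1 (Lg i); congr L2.
by apply/funext => x; rewrite /= mxE.
Qed.

Lemma L2v_integrable_dot g h : L2v D g -> L2v D h ->
  mu.-integrable D (EFin \o (fun x => dot (g x) (h x))).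
Proof.
move=> Lg Lh; have := @integrable_sum _ _ _ mu _ mD 'I_d (index_enum 'I_d) xpredT
  (fun i x => (g x 0 i * h x 0 i)%:E) (fun i _ => L2_integrableM (Lg i) (Lh i)).
by congr (_.-integrable _ _); apply/funext => x; rewrite /= /dot sumEFin.
Qed.

Lemma ipvC g h : ipv D g h = ipv D h g.
Proof. by apply: eq_Rintegral => x _; rewrite dotC. Qed.

Lemma ipvDl g h k : L2v D g -> L2v D h -> L2v D k ->
  ipv D (g \+ h) k = ipv D g k + ipv D h k.
Proof.
move=> Lg Lh Lk; rewrite /ipv -RintegralD//; [|exact: L2v_integrable_dot..].
by apply: eq_Rintegral => x _ /=; rewrite dotDl.
Qed.

Lemma ipvDr g h k : L2v D g -> L2v D h -> L2v D k ->
  ipv D k (g \+ h) = ipv D k g + ipv D k h.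
Proof. by move=> Lg Lh Lk; rewrite !(ipvC k) ipvDl. Qed.

Lemma ipvZl a g k : L2v D g -> L2v D k ->
  ipv D (fun x => a *: g x) k = a * ipv D g k.
Proof.
move=> Lg Lk; rewrite /ipv -RintegralZl//; last exact: L2v_integrable_dot.
by apply: eq_Rintegral => x _ /=; rewrite dotZl.
Qed.

Lemma ipvZr a g k : L2v D g -> L2v D k ->
  ipv D k (fun x => a *: g x) = a * ipv D k g.
Proof. by move=> Lg Lk; rewrite !(ipvC k) ipvZl. Qed.

Lemma ipvNl g k : L2v D g -> L2v D k -> ipv D (\- g) k = - ipv D g k.
Proof.
move=> Lg Lk; rewrite -mulN1r -ipvZl//; congr ipv.
by apply/funext => x /=; rewrite scaleN1r.
Qed.

Lemma ipvBl g h k : L2v D g -> L2v D h -> L2v D k ->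
  ipv D (g \- h) k = ipv D g k - ipv D h k.
Proof. by move=> Lg Lh Lk; rewrite -ipvNl// -ipvDl//; exact: L2vN. Qed.

Lemma ipvBr g h k : L2v D g -> L2v D h -> L2v D k ->
  ipv D k (g \- h) = ipv D k g - ipv D k h.
Proof. by move=> Lg Lh Lk; rewrite !(ipvC k) ipvBl. Qed.

Lemma ipv_suml (I : Type) (s : seq I) (F : I -> pt -> pt) k :
  (forall i, L2v D (F i)) -> L2v D k ->
  ipv D (fun x => \sum_(i <- s) F i x) k = \sum_(i <- s) ipv D (F i) k.
Proof.
move=> LF Lk; elim: s => [|i s IH].
  rewrite big_nil /ipv; under eq_Rintegral do rewrite big_nil.
  rewrite -[RHS](mul0r (ipv D k k)) -ipvZl//; apply: eq_Rintegral => x _.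
  by rewrite scale0r.
rewrite big_cons -IH -ipvDl//; last exact: L2v_sum.
by apply: eq_Rintegral => x _; rewrite big_cons.
Qed.

Lemma ip_suml (I : Type) (s : seq I) (F : I -> pt -> R) w :
  (forall i, L2 D (F i)) -> L2 D w ->
  ip D (fun x => \sum_(i <- s) F i x) w = \sum_(i <- s) ip D (F i) w.
Proof.
move=> LF Lw; elim: s => [|i s IH].
  rewrite big_nil /ip; under eq_Rintegral do rewrite big_nil.
  rewrite -[RHS](mul0r (ip D w w)) -ipZl//; apply: eq_Rintegral => x _.
  by rewrite !mul0r.
rewrite big_cons -IH -ipDl//; last exact: L2_sum.
by apply: eq_Rintegral => x _; rewrite big_cons.
Qed.

Lemma ipv_ge0 g : 0 <= ipv D g g.
Proof. by apply: Rintegral_ge0 => x _; exact: dot_ge0. Qed.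

Lemma nrmv_ge0 g : 0 <= nrmv D g.
Proof. exact: sqrtr_ge0. Qed.

Lemma nrmvE g : nrmv D g ^+ 2 = ipv D g g.
Proof. by rewrite sqr_sqrtr// ipv_ge0. Qed.

Lemma ipv_CS g h : L2v D g -> L2v D h -> `|ipv D g h| <= nrmv D g * nrmv D h.
Proof.
move=> Lv Lw; rewrite -(@ler_pXn2r _ 2) ?nnegrE ?mulr_ge0 ?nrmv_ge0//.
rewrite real_normK ?num_real// exprMn !nrmvE; apply: quadratic_ge0_discr; first exact: ipv_ge0.
move=> t; have Ltw := L2vZ t Lw; have := ipv_ge0 (g \+ (fun x => t *: h x)).
rewrite ipvDl ?(ipvDr _ _ Lv) ?(ipvDr _ _ Ltw)//; last exact: L2vD.
by rewrite !ipvZl// !ipvZr// (ipvC h g); congr (_ <= _); ring.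
Qed.

(** The difference G - F agrees almost everywhere with its absolute value. This reduces the
    inequality to invariance of the integral under almost-everywhere equality. *)
Lemma ae_le_Rintegral (F G : pt -> R) : mu.-integrable D (EFin \o F) ->
  mu.-integrable D (EFin \o G) -> {ae mu, forall x, D x -> F x <= G x} ->
  Rintegral mu D F <= Rintegral mu D G.
Proof.
move=> iF iG FG; rewrite -subr_ge0 -RintegralB//.
have /integrableP[mGF _] := integrableB mD iG iF.
have -> : Rintegral mu D (fun x => G x - F x) = Rintegral mu D (fun x => `|G x - F x|).
  congr fine; apply: ae_eq_integral => //.
    apply/measurable_EFinP; apply: measurableT_comp => //; exact/measurable_EFinP.
  apply: filterS FG => x FG Dx /=; congr EFin.
  by rewrite ger0_norm// subr_ge0 FG.
exact: Rintegral_ge0.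
Qed.

Lemma ae_eq_Rintegral (F G : pt -> R) : mu.-integrable D (EFin \o F) ->
  mu.-integrable D (EFin \o G) -> {ae mu, forall x, D x -> F x = G x} ->
  Rintegral mu D F = Rintegral mu D G.
Proof.
move=> iF iG FG; apply/eqP; rewrite eq_le !ae_le_Rintegral//;
  by apply: filterS FG => x FG /FG ->.
Qed.

End fixed_domain.

Section two_domains.
Variables D E : set pt.
Hypotheses (mD : measurable D) (mE : measurable E) (ED : E `<=` D).

Lemma L2S v : L2 D v -> L2 E v.
Proof.
move=> Lv; have [mv _] := Lv; apply: L2P; first exact: measurable_funS mv.
exact: (integrableS mD mE ED (L2_integrable_sqr Lv)).
Qed.

Lemma L2vS g : L2v D g -> L2v E g.
Proof. by move=> Lg i; exact: L2S. Qed.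

Definition zext v : pt -> R := fun x => if x \in E then v x else 0.

Definition zextv g : pt -> pt := fun x => if x \in E then g x else 0.

Lemma Rintegral_zext (F G : pt -> R) : (forall x, E x -> F x = G x) ->
  (forall x, D x -> ~ E x -> F x = 0) -> Rintegral mu D F = Rintegral mu E G.
Proof.
move=> FG F0; rewrite [RHS]Rintegral_mkcond Rintegral_mkcond; apply: eq_Rintegral => x _.
rewrite /functions.patch; case: (boolP (x \in D)) => [/set_mem xD|/negP xD]; last first.
  by rewrite ifF//; apply/negP => /set_mem/ED/mem_set.
case: (boolP (x \in E)) => [/set_mem xE|/negP xE]; first exact: FG.
by apply: F0 => // /mem_set.
Qed.

Lemma L2_zext v : L2 E v -> L2 D (zext v).
Proof.
move=> [mv v2]; split.
  by apply/measurable_restrict => //; rewrite setIidr.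
rewrite (_ : (fun x => _) = (fun x => (v x ^+ 2)%:E) \_ E).
  by rewrite -integral_mkcondr setIidr.
by apply/funext => x; rewrite /zext /functions.patch; case: ifP => //; rewrite expr0n.
Qed.

Lemma L2v_zext g : L2v E g -> L2v D (zextv g).
Proof.
move=> Lg i; have := L2_zext (Lg i); congr L2.
by apply/funext => x; rewrite /zext /zextv; case: ifP => //; rewrite mxE.
Qed.

Lemma ip_zext v w : ip D (zext v) w = ip E v w.
Proof.
apply: Rintegral_zext => x; rewrite /zext; first by move=> xE; rewrite mem_set.
by move=> _ nE; rewrite memNset// mul0r.
Qed.

Lemma ipv_zext g h : ipv D (zextv g) h = ipv E g h.
Proof.
apply: Rintegral_zext => x; rewrite /zextv; first by move=> xE; rewrite mem_set.
by move=> _ nE; rewrite memNset// /dot big1// => i _; rewrite mxE mul0r.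
Qed.

Lemma nrmv_zext g : nrmv D (zextv g) = nrmv E g.
Proof.
congr Num.sqrt; rewrite ipv_zext; apply: eq_Rintegral => x xE.
by rewrite /zextv xE.
Qed.

End two_domains.

(** Cauchy-Schwarz is applied pointwise after discarding the zero terms, so the factor is the
    overlap N and not the length of s. *)
Lemma overlap_sum D (s : seq pt) (F : pt -> pt -> pt) (N : nat) : measurable D ->
  (forall a, L2v D (F a)) ->
  {ae mu, forall x, D x -> (size [seq a <- s | F a x != 0%R] <= N)%N} ->
  nrmv D (fun x => \sum_(a <- s) F a x) ^+ 2 <= N%:R * \sum_(a <- s) nrmv D (F a) ^+ 2.
Proof.
move=> mD LF FN; rewrite nrmvE.
have iF a : mu.-integrable D (EFin \o (fun x => N%:R * dot (F a x) (F a x))).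
  exact: (integrableZl mD N%:R (L2v_integrable_dot mD (LF a) (LF a))).
have iFs (t : seq pt) : mu.-integrable D
    (EFin \o (fun x => \sum_(a <- t) N%:R * dot (F a x) (F a x))).
  have := @integrable_sum _ _ _ mu _ mD _ t xpredT _ (fun a _ => iF a).
  by congr (_.-integrable _ _); apply/funext => x; rewrite /= sumEFin.
have -> : N%:R * \sum_(a <- s) nrmv D (F a) ^+ 2 =
    Rintegral mu D (fun x => \sum_(a <- s) N%:R * dot (F a x) (F a x)).
  elim: s {FN} => [|a s IH].
    rewrite big_nil mulr0; under eq_Rintegral do rewrite big_nil.
    by rewrite Rintegral_cst// mul0r.
  rewrite big_cons mulrDr IH; under [RHS]eq_Rintegral do rewrite big_cons.
  rewrite RintegralD//; congr (_ + _); rewrite RintegralZl// ?nrmvE//.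
  exact: L2v_integrable_dot.
apply: ae_le_Rintegral => //.
  by apply: L2v_integrable_dot => //; exact: L2v_sum.
apply: filterS FN => x FN /FN{FN} FN.
have sumF (G : pt -> R) : (forall a, F a x = 0 -> G a = 0) ->
    \sum_(a <- s) G a = \sum_(a <- [seq a <- s | F a x != 0]) G a.
  move=> G0; rewrite big_filter [RHS]big_mkcond; apply: eq_bigr => a _.
  by case: eqP => // /G0.
rewrite -mulr_sumr sumF => [|a ->]; last first.
  by rewrite /dot big1// => i _; rewrite mxE mul0r.
rewrite {1}/dot exchange_big/= mulr_sumr; apply: ler_sum => i _.
rewrite !summxE sumF => [|a ->]; last by rewrite mxE.
rewrite -expr2 (le_trans (sqr_sum_le _ _))//.
under [X in _ <= _ * X]eq_bigr do rewrite -expr2.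
by rewrite ler_wpM2r// ?ler_nat// sumr_ge0// => a _; exact: sqr_ge0.
Qed.

End L2_theory.

(** * Test functions and H^1_0 *)

Section test_functions.
Variables (R : realType) (d : nat).
Local Notation pt := 'rV[R]_d.
Local Notation mu := (leb R d).
Implicit Types (D E : set pt) (v w phi : pt -> R) (g h : pt -> pt).

Lemma compact_support_bounded (C : set pt) (F : pt -> R) : compact C -> continuous F ->
  (forall x, ~ C x -> F x = 0) -> exists M, forall x, `|F x| <= M.
Proof.
move=> cC cF F0.
have /compact_bounded[M [_ hM]] : compact (F @` C).
  by apply: continuous_compact => //; exact: continuous_subspaceT.
exists (`|M| + 1) => x; have [Cx|/F0 ->] := pselect (C x); last first.
  by rewrite normr0 addr_ge0.
by apply: hM; [rewrite (le_lt_trans (ler_norm _))// ltrDl|exists x].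
Qed.

Lemma bounded_L2 E (F : pt -> R) M : measurable E -> (mu E < +oo)%E ->
  measurable_fun E F -> (forall x, `|F x| <= M) -> L2 E F.
Proof.
move=> mE Eoo mF FM; apply: L2P => //.
apply: (measurable_bounded_integrable (f := fun x => F x ^+ 2)) => //.
  exact: measurable_funX.
exists (M ^+ 2); split; first exact: num_real.
move=> y My x _ /=; rewrite ger0_norm ?sqr_ge0// (le_trans _ (ltW My))//.
by rewrite -real_normK ?num_real// lerXn2r ?nnegrE// (le_trans (normr_ge0 _) (FM x)).
Qed.

Definition supp phi : set pt := closure [set x | phi x != 0].

Lemma notin_supp phi x : ~ supp phi x -> \near x, phi x = 0.
Proof.
move=> xs; have : open (~` supp phi) by apply/closed_openC/closed_closure.
rewrite openE => /(_ x xs); apply: filterS => y /= ys.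
by apply/eqP; apply: contra_notT ys => y0; exact: subset_closure.
Qed.

Lemma supp0 phi x : ~ supp phi x -> phi x = 0.
Proof. by move/notin_supp/nbhs_singleton. Qed.

Lemma partial_supp0 phi i x : ~ supp phi x -> partial i phi x = 0.
Proof.
move=> /notin_supp phi0; rewrite /partial.
by rewrite (near_eq_derive _ (g := cst 0))// derive_cst.
Qed.

Lemma grad_supp0 phi x : ~ supp phi x -> grad phi x = 0.
Proof. by move=> xs; apply/rowP => i; rewrite !mxE partial_supp0. Qed.

Section in_finite_measure.
Variable E : set pt.
Hypotheses (mE : measurable E) (Eoo : (mu E < +oo)%E).

Lemma test_fun_L2 D phi : test_fun D phi -> L2 E phi.
Proof.
move=> [Cphi cphi _]; have [M hM] := compact_support_bounded cphi (Cphi 0) (@supp0 phi).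
exact: (bounded_L2 mE Eoo (continuous_measurable_rV mE (Cphi 0)) hM).
Qed.

Lemma test_fun_grad_L2 D phi : test_fun D phi -> L2v E (grad phi).
Proof.
move=> [Cphi cphi _] i; have [_ /(_ i)[_ ci]] := Cphi 1.
have [M hM] := compact_support_bounded cphi ci (@partial_supp0 phi i).
have := bounded_L2 mE Eoo (continuous_measurable_rV mE ci) hM; congr L2.
by apply/funext => x; rewrite mxE.
Qed.

End in_finite_measure.

Lemma test_funS D E phi : D `<=` E -> test_fun D phi -> test_fun E phi.
Proof. by move=> DE [? ? h]; split => //; exact: subset_trans DE. Qed.

(** The left-hand side is continuous in the H^1 norm and vanishes on test functions, hence on their
    closure. It will carry the weak divergence of the flux over to u and u_l. *)
Lemma H10_limit D v h (a : pt -> R) (b : pt -> pt) :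
  measurable D -> (mu D < +oo)%E -> L2 D a -> L2v D b ->
  (forall phi, test_fun D phi -> ip D a phi + ipv D b (grad phi) = 0) ->
  H10 D v h -> ip D a v + ipv D b h = 0.
Proof.
move=> mD Doo La Lb H [Lv Lh [phi [tphi cv ch]]].
set c := (X in X = 0).
have Lphi n : L2 D (phi n) := test_fun_L2 mD Doo (tphi n).
have Lgphi n : L2v D (grad (phi n)) := test_fun_grad_L2 mD Doo (tphi n).
have bnd n : `|c| <= nrm D a * nrm D (phi n \- v) + nrmv D b * nrmv D (grad (phi n) \- h).
  have -> : c = - (ip D a (phi n \- v) + ipv D b (grad (phi n) \- h)).
    rewrite ipvBr// (ipC D a) ipBl// -(ipC D a) -(ipC D a v) /c.
    have := H _ (tphi n); lra.
  rewrite normrN (le_trans (ler_normD _ _))// lerD//.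
    by apply: ip_CS => //; exact: L2B.
  by apply: ipv_CS => //; exact: L2vB.
apply/eqP; rewrite -normr_le0.
have lim0 : (fun n => nrm D a * nrm D (phi n \- v) + nrmv D b * nrmv D (grad (phi n) \- h))
    @ \oo --> (nrm D a * 0 + nrmv D b * 0).
  by apply: cvgD; exact: cvgMl_tmp.
rewrite !mulr0 addr0 in lim0.
by apply: (cvgr_to_ge lim0); near do exact: bnd.
Unshelve. all: by end_near. Qed.

(** The same approximating sequence serves on D: its members and their gradients vanish outside E,
    so the norms over D and E coincide. *)
Lemma H10_zext D E v h : measurable D -> measurable E -> E `<=` D -> H10 E v h ->
  H10 D (zext E v) (zextv E h).
Proof.
move=> mD mE ED [Lv Lh [phi [tphi cv ch]]]; split.
- exact: L2_zext.
- exact: L2v_zext.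
exists phi; split => [n||]; first exact: test_funS (tphi n).
- rewrite (_ : (fun _ => _) = fun n => nrm E (phi n \- v))//.
  apply/funext => n; congr Num.sqrt; apply: Rintegral_zext => // x.
    by move=> Ex; rewrite /= /zext mem_set.
  move=> _ nE; rewrite /= /zext memNset// subr0.
  have [_ _ sE] := tphi n.
  by rewrite supp0 ?mul0r// => /sE.
- rewrite (_ : (fun _ => _) = fun n => nrmv E (grad (phi n) \- h))//.
  apply/funext => n; congr Num.sqrt; apply: Rintegral_zext => // x.
    by move=> Ex; rewrite /= /zextv mem_set.
  move=> _ nE; rewrite /= /zextv memNset// subr0.
  have [_ _ sE] := tphi n.
  rewrite grad_supp0 ?/dot => [|/sE//].
  by rewrite big1// => i _; rewrite mxE mul0r.
Qed.

(** Neighbourhoods come from the sup norm, the Lipschitz condition from the Euclidean one;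
    continuity of the latter links the two. *)
Lemma enorm_near (x y : pt) (e : R) : enorm (y - x) < e ->
  \forall z \near y, enorm (z - x) < e.
Proof.
have : continuous (fun z : pt => enorm (z - x)).
  move=> z; apply: (@continuous_comp _ _ _ (fun z : pt => dot (z - x) (z - x)) Num.sqrt);
    last exact: sqrt_continuous.
  rewrite (_ : (fun y => _) = fun y : pt => \sum_i (y 0 i - x 0 i) * (y 0 i - x 0 i)); last first.
    by apply/funext => t; rewrite /dot; apply: eq_bigr => i _; rewrite !mxE.
  apply: continuous_big => [|i _ t]; first exact: add_continuous.
  have c : (fun y : pt => y 0 i - x 0 i) t' @[t' --> t] --> t 0 i - x 0 i.
    apply: (@cvgB _ _ _ (nbhs t) _ (fun y : pt => y 0 i) (cst (x 0 i))).
      exact: coord_continuous.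
    exact: cvg_cst.
  exact: (cvgM c c).
move=> c h; apply: (c y [set t | t < e]).
by apply: open_nbhs_nbhs; split => //; exact: open_lt.
Qed.

(** A point x outside D but interior to [closure D] would be a boundary point on or above the local
    graph. Pushing it along e gives a point of [closure D] strictly above the graph, and points of D
    cannot come close to it. *)
Lemma interior_closure_lipschitz D : open D -> lipschitz_boundary D ->
  (closure D)° = D.
Proof.
move=> oD lD; apply/seteqP; split; last first.
  move=> x Dx; apply: (interiorS (@subset_closure _ D)).
  by rewrite (interior_id _).1.
move=> x ix; apply: contrapT => nDx.
have [e [g [L [r [e1 r0 gL ge gD]]]]] : exists (e : pt) (g : pt -> R) (L r : R),
    [/\ enorm e = 1, 0 < r, forall y z, `|g y - g z| <= L * enorm (y - z),
        forall y t, g (y + t *: e) = g y &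
        forall y, enorm (y - x) < r -> (D y <-> dot y e < g y)].
  apply: lD; split; first exact: interior_subset.
  by rewrite (interior_id _).1.
have e11 : dot e e = 1.
  by rewrite -[RHS](expr1n _ 2) -e1 sqr_sqrtr// dot_ge0.
have enorm0 (y : pt) : enorm (y - y) = 0.
  by rewrite subrr /enorm /dot big1 ?sqrtr0// => i _; rewrite mxE mul0r.
have gx : g x <= dot x e.
  by rewrite leNgt; apply/negP => /gD; rewrite enorm0 => /(_ r0).
have cy : x + t *: e @[t --> (0:R)] --> x.
  have : x + t *: e @[t --> (0:R)] --> x + 0 *: e.
    by apply: cvgD; [exact: cvg_cst|apply: cvgZr_tmp; exact: cvg_id].
  by rewrite scale0r addr0.
have [t [t0 ct tr]] : exists t, [/\ 0 < t, closure D (x + t *: e) & enorm (x + t *: e - x) < r].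
  have n1 : \forall t \near (0:R), closure D (x + t *: e) by exact: (cy _ ix).
  have n2 : \forall t \near (0:R), enorm (x + t *: e - x) < r.
    apply: (cy [set z | enorm (z - x) < r]).
    by apply: enorm_near; rewrite enorm0.
  have [s /= s0 sP] := (nbhs_ballP _ _).1 (filterI n1 n2).
  have : ball (0:R) s (s / 2) by rewrite /ball/= sub0r normrN gtr0_norm; lra.
  by move=> /sP[? ?]; exists (s / 2); split => //; lra.
set y := x + t *: e in ct tr.
(* The point y lies at least t above the graph. Within distance k of y, the graph rises by at most
   [|L| * k], and the height of the chosen z drops by less than k. A point of D there would give t <
   (|L| + 1) k, against t = (|L| + 2) k. *)
pose k := t / (`|L| + 2).
have k0 : 0 < k by rewrite divr_gt0// addr_gt0.
have n1 : \forall z \near y, enorm (z - y) < k by apply: enorm_near; rewrite enorm0.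
have n2 : \forall z \near y, dot y e - k < dot e z.
  apply: (@dot_continuous _ _ e y [set s | dot y e - k < s]).
  apply: open_nbhs_nbhs; split => /=; first exact: open_gt.
  by rewrite (dotC e) ltrBlDr ltrDl.
have [z [Dz [[zy ze] zr]]] := ct _ (filterI (filterI n1 n2) (enorm_near tr)).
move/(gD z zr) : Dz; rewrite dotC => Dz.
have gzy : g z <= g y + `|L| * k.
  rewrite -lerBlDl (le_trans (ler_norm _))// (le_trans (gL _ _))//.
  rewrite (le_trans (ler_wpM2r (sqrtr_ge0 _) (ler_norm L)))// ler_wpM2l//.
  exact: ltW.
have yt : dot y e = dot x e + t by rewrite /y dotDl dotZl e11 mulr1.
have gy : g y = g x by exact: ge.
have : t < (`|L| + 1) * k.
  by rewrite gy in gzy; rewrite yt in ze; nra.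
have : t = (`|L| + 2) * k by rewrite /k mulrC divfK// gt_eqF// addr_gt0.
by move: k0; clearbody k => k0 tk; rewrite {1}tk; nra.
Qed.

End test_functions.

(** * Hat functions and projections *)

Section polynomials.
Import -(notations) mpoly.
Variables (R : realType) (d : nat).
Local Notation pt := 'rV[R]_d.
Implicit Types (K : simplex R d) (x : pt) (q : mpoly d R) (p n : nat).

Lemma degleD p q1 q2 : degle p q1 -> degle p q2 -> degle p (q1 + q2).
Proof.
move=> h1 h2; rewrite /degle (leq_trans (msizeD_le _ _))// geq_max.
by apply/andP.
Qed.

Lemma degle0 p : degle p (0 : mpoly d R).
Proof. by rewrite /degle msize0. Qed.

Lemma degle_sum p (I : Type) (s : seq I) (P : pred I) (F : I -> mpoly d R) :
  (forall i, degle p (F i)) -> degle p (\sum_(i <- s | P i) F i).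
Proof. by move=> hF; elim/big_ind : _ => //; [exact: degle0|exact: degleD]. Qed.

Lemma degleN p q : degle p q -> degle p (- q).
Proof. by rewrite /degle msizeN. Qed.

Lemma degleM n p q1 q2 : degle n q1 -> degle p q2 -> degle (n + p) (q1 * q2).
Proof.
have [->|q10] := eqVneq q1 0; first by rewrite mul0r => *; exact: degle0.
have [->|q20] := eqVneq q2 0; first by rewrite mulr0 => *; exact: degle0.
rewrite /degle msizeM//; set a := mmeasure _ q1; set b := mmeasure _ q2.
by move: a b => a b; lia.
Qed.

Lemma pevalD q1 q2 x : peval (q1 + q2) x = peval q1 x + peval q2 x.
Proof. exact: mevalD. Qed.

Lemma pevalN q x : peval (- q) x = - peval q x.
Proof. exact: mevalN. Qed.

Lemma pevalM q1 q2 x : peval (q1 * q2) x = peval q1 x * peval q2 x.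
Proof. exact: mevalM. Qed.

Lemma peval0 x : peval (0 : mpoly d R) x = 0.
Proof. exact: meval0. Qed.

Lemma peval_sum (I : Type) (s : seq I) (P : pred I) (F : I -> mpoly d R) x :
  peval (\sum_(i <- s | P i) F i) x = \sum_(i <- s | P i) peval (F i) x.
Proof. exact: (big_morph (fun q => peval q x) (fun q1 q2 => pevalD q1 q2 x) (peval0 x)). Qed.

Lemma affine_poly (c : R) (b : pt) : exists2 q : mpoly d R, degle 1 q &
  forall x, peval q x = c + dot b x.
Proof.
exists (mpolyC d c + \sum_(j < d) b 0 j *: mpolyX R (mnm1 j)).
  apply: degleD; first by rewrite /degle msizeC; case: (c == 0).
  apply: degle_sum => j; rewrite /degle (leq_trans (msizeZ_le _ _))//.
  by rewrite msizeX mdeg1.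
move=> x; rewrite pevalD /peval mevalC; congr (_ + _).
rewrite -/(peval _ x) peval_sum; apply: eq_bigr => j _.
by rewrite /peval mevalZ mevalXU.
Qed.

(** Monomial by monomial: degree at most 1 leaves the constant, settled by the weights summing to 1,
    and single coordinates, settled by linearity. *)
Lemma degle1_affine K q (w : 'rV[R]_d.+1) : degle 1 q -> \sum_i w 0 i = 1 ->
  peval q (w *m K.1) = \sum_i w 0 i * peval q (row i K.1).
Proof.
move=> q1 w1; rewrite /peval mevalE.
under [RHS]eq_bigr => i _ do rewrite mevalE mulr_sumr.
rewrite exchange_big/= !big_seq; apply: eq_bigr => m mq.
under [RHS]eq_bigr do rewrite mulrCA; rewrite -mulr_sumr; congr (_ * _).
have : (mdeg m <= 1)%N by rewrite -ltnS (leq_trans (msize_mdeg_lt mq)).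
rewrite leq_eqVlt => /predU1P[/eqP/mdeg1P[j /eqP ->]|]; last first.
  rewrite ltnS leqn0 mdeg_eq0 => /eqP ->.
  rewrite big1 => [|i _]; last by rewrite mnm0E expr0.
  rewrite -[LHS]w1; apply: eq_bigr => i _.
  by rewrite big1 ?mulr1// => k _; rewrite mnm0E expr0.
have mE (v : 'I_d -> R) : \prod_i v i ^+ mnm1 j i = v j.
  rewrite (bigD1 j)//= mnm1E eqxx expr1 big1 ?mulr1// => i ij.
  by rewrite mnm1E eq_sym (negbTE ij) expr0.
rewrite mE mxE; apply: eq_bigr => i _; by rewrite mE mxE.
Qed.

Lemma lam_poly K i : exists2 q : mpoly d R, degle 1 q &
  forall x, lam K x 0 i = peval q x.
Proof.
have [q q1 qE] := affine_poly (invmx (ext K) 0 i) (\row_j invmx (ext K) (rshift 1 j) i).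
by exists q => // x; rewrite lamE qE.
Qed.

Lemma wt_poly K a : exists2 q : mpoly d R, degle 1 q &
  forall x, wt K a x = peval q x.
Proof.
have /(@choice _ _ _)[Q QP] (i : 'I_d.+1) : exists q : mpoly d R,
    degle 1 q /\ forall x, lam K x 0 i = peval q x.
  by have [q ? ?] := lam_poly K i; exists q.
exists (\sum_(i | row i K.1 == a) Q i).
  by apply: degle_sum => i; have [] := QP i.
by move=> x; rewrite peval_sum; apply: eq_bigr => i _; have [_] := QP i.
Qed.

Lemma pw_polyB p (T : mesh R d) v w : pw_poly p T v -> pw_poly p T w -> pw_poly p T (v \- w).
Proof.
move=> pv pw K KT; have [q1 d1 E1] := pv K KT; have [q2 d2 E2] := pw K KT.
exists (q1 - q2); first by apply: degleD => //; exact: degleN.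
by move=> x Kx; rewrite /= E1// E2// pevalD pevalN.
Qed.

Lemma pw_polyM n p (T : mesh R d) v w :
  pw_poly n T v -> pw_poly p T w -> pw_poly (n + p) T (v \* w).
Proof.
move=> pv pw K KT; have [q1 d1 E1] := pv K KT; have [q2 d2 E2] := pw K KT.
exists (q1 * q2); first exact: degleM.
by move=> x Kx; rewrite /= E1// E2// pevalM.
Qed.

Lemma pw_poly_extend p (S : mesh R d) (P : set (simplex R d)) v :
  (forall K, K \in S -> P K -> exists2 q, degle p q &
    forall x, (hull K)° x -> v x = peval q x) ->
  (forall K, K \in S -> ~ P K -> forall x, (hull K)° x -> v x = 0) ->
  pw_poly p S v.
Proof.
move=> h1 h2 K KS; have [PK|nPK] := pselect (P K); first exact: h1.
by exists 0; [exact: degle0|move=> x Kx; rewrite peval0 (h2 K)].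
Qed.

End polynomials.

Section hat_function.
Variables (R : realType) (d : nat).
Local Notation pt := 'rV[R]_d.
Local Notation mu := (leb R d).
Variable T : mesh R d.
Hypothesis nT : forall K, K \in T -> nondegenerate K.
Hypothesis cT : conforming T.
Implicit Types (K : simplex R d) (x a : pt).

Lemma wt_vertex K a : K \in T -> a \in vertices T -> hull K a -> wt K a a = 1.
Proof.
move=> KT aT Ka; have /imfsetP[i _ ->] := conf_vertex nT cT KT aT Ka.
by have nK := nT KT; rewrite wt_row// lam_row// mxE !eqxx.
Qed.

Lemma wt_other K a b : nondegenerate K -> b \in verts K -> b != a -> wt K a b = 0.
Proof.
move=> nK /imfsetP[j _ ->] ba; rewrite /wt big1// => i /eqP ia.
rewrite lam_row// mxE eqxx/=; case: eqP => // ij.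
by rewrite -ij ia eqxx in ba.
Qed.

(** Since [hat] is chosen by [xget], its specification holds once some function satisfies it; the
    gluing of the [wt K a] does. The specification then fixes the values at the vertices, and
    affinity fixes those on each simplex. *)
Lemma hatE a K x : a \in vertices T -> K \in T -> hull K x -> hat T a x = wt K a x.
Proof.
move=> aT KT Kx; pose P := [set psi : pt -> R | [/\
    forall K, K \in T -> exists2 q, degle 1 q & forall x, hull K x -> psi x = peval q x,
    psi a = 1 & forall b, b \in vertices T -> b != a -> psi b = 0]].
have [psi0 Ppsi0] : P !=set0.
  pose psi x := xget 0 [set y | exists K, [/\ K \in T, hull K x & y = wt K a x]].
  have psiE K' y : K' \in T -> hull K' y -> psi y = wt K' a y.
    move=> K'T K'y; rewrite /psi; case: xgetP => [_ -> [K'' [K''T K''y ->]]|/(_ (wt K' a y))].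
      exact: (wt_conf nT cT).
    by move=> /(_ _)[]; exists K'.
  exists psi; split => [K' K'T||b bT ba].
  - have [q q1 qE] := wt_poly K' a.
    by exists q => // y /(psiE _ _ K'T) ->.
  - move/bigfcupP : (aT) => [K' /andP[K'T _] aK'].
    have K'a := verts_hull (nT K'T) aK'.
    by rewrite (psiE K')// wt_vertex.
  - move/bigfcupP : bT => [K' /andP[K'T _] bK'].
    have K'b := verts_hull (nT K'T) bK'.
    by rewrite (psiE K')// wt_other//; exact: nT.
have [h1 h2 h3] : P (hat T a) := xgetPex (fun=> 0) (ex_intro _ psi0 Ppsi0).
have [q q1 qE] := h1 K KT; have nK := nT KT.
rewrite qE// -[in LHS](lam_mul x nK) degle1_affine ?sum_lam//.
rewrite /wt [RHS]big_mkcond; apply: eq_bigr => i _.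
rewrite -qE; last exact: row_hull.
have [->|ia] := eqVneq (row i K.1) a; first by rewrite h2 mulr1.
by rewrite h3 ?mulr0//; exact: (verts_vertices KT (row_verts _ _)).
Qed.

Lemma wt_ge0 K a x : nondegenerate K -> hull K x -> 0 <= wt K a x.
Proof. by move=> nK Kx; apply: sumr_ge0 => i _; exact: hull_ge0. Qed.

Lemma wt_le1 K a x : nondegenerate K -> hull K x -> wt K a x <= 1.
Proof.
move=> nK Kx; rewrite -(sum_lam x nK) [leRHS](bigID (fun i => row i K.1 == a))/=.
by rewrite lerDl; apply: sumr_ge0 => i _; exact: hull_ge0.
Qed.

Lemma hat_bounded a x : a \in vertices T -> msupport T x -> `|hat T a x| <= 1.
Proof.
move=> aT [K KT Kx]; have nK := nT KT; rewrite (hatE aT KT Kx).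
by rewrite ger0_norm ?wt_ge0// wt_le1.
Qed.

Lemma wt_continuous K a : continuous (wt K a).
Proof.
by apply: continuous_big => [|i _]; [exact: add_continuous|exact: lam_continuous].
Qed.

Lemma hat_measurable a D : a \in vertices T -> measurable D -> D `<=` msupport T ->
  measurable_fun D (hat T a).
Proof.
move=> aT mD DT; have [K0 K0T _] : exists2 K, K \in T & a \in verts K.
  by move/bigfcupP : (aT) => [K /andP[KT _] aK]; exists K.
(* The finite list of simplices is continued by the default [K0], which gives a union over all
   natural numbers. *)
pose E k := D `&` hull (nth K0 T k).
have memT k : nth K0 T k \in T.
  by have [kT|kT] := ltnP k (size T); [exact: mem_nth|rewrite nth_default].
have mE k : measurable (E k).
  by apply: measurableI => //; apply: closed_measurable_rV; apply: hull_closed; exact: nT.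
have -> : D = \bigcup_k E k.
  rewrite eqEsubset; split => [x Dx|x [k _ []]//].
  have [K KT Kx] := DT _ Dx; exists (index K T) => //.
  by split => //; rewrite nth_index.
apply/measurable_fun_bigcup => // k.
apply: (eq_measurable_fun (wt (nth K0 T k) a)).
  by move=> x /set_mem[_ Kx]; rewrite (hatE aT (memT k) Kx).
exact: (continuous_measurable_rV (mE k) (@wt_continuous _ _)).
Qed.

Lemma sum_vertices (V : nmodType) K (F : 'I_d.+1 -> V) : K \in T ->
  \sum_(a <- vertices T) \sum_(i | row i K.1 == a) F i = \sum_i F i.
Proof.
move=> KT; rewrite (exchange_big_dep predT)//=; apply: eq_bigr => i _.
have iT : row i K.1 \in vertices T := verts_vertices KT (row_verts K i).
rewrite -big_filter (_ : [seq _ <- _ | _] = [:: row i K.1]) ?big_seq1//.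
rewrite -(filter_pred1_uniq (fset_uniq _) iT).
by apply: eq_filter => a /=; rewrite eq_sym.
Qed.

Lemma sum_hat x : msupport T x -> \sum_(a <- vertices T) hat T a x = 1.
Proof.
move=> [K KT Kx]; rewrite -(sum_lam x (nT KT)) -(sum_vertices _ KT).
by rewrite big_seq [RHS]big_seq; apply: eq_bigr => a aT; rewrite (hatE aT KT Kx).
Qed.

(** The constant gradient of [wt K a], read off from [lamE]. *)
Definition wt_slope K a : pt :=
  \sum_(i | row i K.1 == a) \row_j invmx (ext K) (rshift 1 j) i.

Lemma wt_affine K a (h : R) x v : wt K a (x + h *: v) = wt K a x + h * dot (wt_slope K a) v.
Proof.
rewrite /wt; have -> : dot (wt_slope K a) v = \sum_(i | row i K.1 == a)
    dot (\row_j invmx (ext K) (rshift 1 j) i) v.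
  rewrite /dot exchange_big/=; apply: eq_bigr => j _.
  by rewrite /wt_slope summxE mulr_suml.
rewrite mulr_sumr -big_split; apply: eq_bigr => i _ /=.
by rewrite !lamE -addrA; congr (_ + _); rewrite dotC dotDl dotZl !(dotC _ (\row__ _)).
Qed.

Lemma derive_affine (F : pt -> R) x v c : (forall h : R, F (x + h *: v) = F x + h * c) ->
  'D_v F x = c.
Proof.
move=> Fc; apply: lim_near_cst => //; near=> h => /=.
have h0 : h != 0 by near: h; exact: nbhs_dnbhs_neq.
by rewrite [h *: v + x]addrC Fc addrAC subrr add0r -[LHS]/(h^-1 * (h * c)) mulKf.
Unshelve. all: by end_near. Qed.

Lemma hat_grad a K x : a \in vertices T -> K \in T -> open_simplex K x ->
  grad (hat T a) x = wt_slope K a.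
Proof.
move=> aT KT oKx; apply/rowP => j; rewrite mxE /partial.
rewrite (near_eq_derive _ (g := wt K a)); last first.
  have /open_nbhs_nbhs : open_nbhs x (open_simplex K) by split=> //; exact: open_simplex_open.
  apply: filterS => y oKy; apply: hatE => //; apply: open_simplex_hull => //; exact: nT.
rewrite (@derive_affine _ x _ (wt_slope K a 0 j))// => h.
rewrite wt_affine; congr (_ + _ * _); rewrite /dot (bigD1 j)//= big1 ?addr0.
  by rewrite mxE !eqxx mulr1.
by move=> i ij; rewrite mxE (negbTE ij) andbF mulr0.
Qed.

(** The barycentric coordinates sum to 1 at every point, so the linear form given by the sum s of
    their slopes is constant, hence zero. *)
Lemma sum_hat_grad K x : K \in T -> open_simplex K x ->
  \sum_(a <- vertices T) grad (hat T a) x = 0.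
Proof.
move=> KT oKx; have nK := nT KT.
rewrite big_seq; under eq_bigr => a aT do rewrite (hat_grad aT KT oKx).
rewrite -big_seq sum_vertices//; set s := \sum_i _.
have sE y : dot s y = 1 - \sum_i invmx (ext K) 0 i.
  rewrite -(sum_lam y nK); under [in RHS]eq_bigr do rewrite lamE.
  rewrite big_split/= addrAC subrr add0r /dot exchange_big/=; apply: eq_bigr => j _.
  by rewrite /s summxE mulr_suml.
apply/rowP => j; have := sE (delta_mx 0 j).
rewrite -(sE 0) /dot (bigD1 j)//= big1 ?addr0 => [|i ij]; last first.
  by rewrite mxE (negbTE ij) andbF mulr0.
rewrite !mxE !eqxx mulr1 => ->; apply: big1 => i _.
by rewrite mxE mulr0.
Qed.

(** The simplices outside the patch have a closed union on which the hat function vanishes. Hence a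
    neighbourhood of x avoids them and is covered by the patch alone. *)
Lemma hat_neq0_omega D a x : a \in vertices T -> open D -> D `<=` msupport T -> D x ->
  hat T a x != 0 -> omega T a x.
Proof.
move=> aT oD DT Dx hx.
pose T' : mesh R d := [fset K in T | K \notin patch T a]%fset.
have T'T K : K \in T' -> K \in T by rewrite !inE => /andP[].
have cT' : closed (msupport T') by apply: msupport_closed => K /T'T; exact: nT.
have nx : ~ msupport T' x.
  move=> [K KT' Kx]; move/negP: hx; apply; rewrite (hatE aT (T'T _ KT') Kx).
  rewrite wt_notin//; move: KT'; rewrite !inE => /andP[KT]; rewrite KT/=.
  by apply: contra => aK; rewrite inE; apply: verts_hull => //; exact: nT.
have : open_nbhs x (D `&` ~` msupport T').
  by split => //; apply: openI => //; exact: closed_openC.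
move/open_nbhs_nbhs; apply: filterS => y [Dy nT'y].
have [K KT Ky] := DT _ Dy; exists K => //.
apply: contrapT => /negP nK; apply: nT'y; exists K => //.
by rewrite !inE KT /=; rewrite in_patch KT/= in nK.
Qed.

(** Boundary points of the patch inside D have hat value 0 by the preceding lemma. So the part of
    the boundary with unrestricted normal trace lies outside D, and the support of phi stays away
    from it. *)
Lemma test_fun_noflux D a phi : a \in vertices T -> open D -> D `<=` msupport T ->
  test_fun D phi ->
  test_fun (~` closure (bdry (omega T a) `\` noflux D T a)) phi.
Proof.
move=> aT oD DT; apply: test_funS => x Dx cx.
have [y [[by_ ny] Dy]] := cx D (open_nbhs_nbhs (conj oD Dx)).
apply: ny; split => //; right; apply: contrapT => /eqP hy.
have [_] := by_; apply; rewrite (interior_id _).1; last exact: omega_open.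
exact: (hat_neq0_omega aT oD DT Dy hy).
Qed.

End hat_function.

Section projection.
Variables (R : realType) (d : nat).
Local Notation pt := 'rV[R]_d.
Local Notation mu := (leb R d).
Implicit Types (T S : mesh R d) (D : set pt) (v w : pt -> R).

Lemma pw_poly_finer p T S v : finer S T -> pw_poly p T v -> pw_poly p S v.
Proof.
move=> ST pv K KS; have [K' K'T KK'] := ST K KS; have [q dq E] := pv K' K'T.
by exists q => // x Kx; apply: E; exact: interiorS Kx.
Qed.

(** The function v itself shows that the set behind [xget] is nonempty. The difference between v and
    the chosen projection is again piecewise polynomial, so it can be tested against itself. *)
Lemma L2proj_id p T D v : measurable D -> L2 D v -> pw_poly p T v ->
  {ae mu, forall x, D x -> L2proj p T D v x = v x}.
Proof.
move=> mD Lv pv; pose P := [set w | [/\ L2 D w, pw_poly p T w &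
    forall w', L2 D w' -> pw_poly p T w' -> ip D (v \- w) w' = 0]].
have [Lw pw orth] : P (L2proj p T D v).
  apply: (xgetPex (fun=> 0)); exists v; split => // w' Lw' _.
  rewrite (_ : v \- v = fun=> 0); last by apply/funext => x /=; rewrite subrr.
  rewrite /ip; under eq_Rintegral do rewrite mul0r.
  by rewrite Rintegral_cst// mul0r.
set w := L2proj p T D v in Lw pw orth *; have Lvw := L2B mD Lv Lw.
have /integrableP[mvw oo] := L2_integrableM mD Lvw Lvw.
have : (\int[mu]_(x in D) `|((v \- w) x * (v \- w) x)%:E| = 0)%E.
  have := orth _ Lvw (pw_polyB pv pw); rewrite /ip /Rintegral.
  rewrite (@eq_integral _ _ _ mu D (fun x => `|((v \- w) x * (v \- w) x)%:E|)%E); last first.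
    by move=> x _; rewrite gee0_abs// lee_fin -expr2 sqr_ge0.
  move=> h; rewrite -[LHS]fineK ?h// ge0_fin_numE//.
  by apply: integral_ge0 => x _; exact: abse_ge0.
move=> /(ae_eq_integral_abs _ mD mvw); apply: filterS => x h /h /= [] /eqP.
by rewrite mulf_eq0 orbb subr_eq0 => /eqP.
Qed.

End projection.

(** * Reliability and efficiency on one level *)

Section one_level.
Variables (R : realType) (d p : nat).
Local Notation pt := 'rV[R]_d.
Local Notation mu := (leb R d).
Variables (Omega : set pt) (T : mesh R d) (f : pt -> R).
Hypotheses (d_gt0 : (0 < d)%N) (p_gt0 : (0 < p)%N).
Hypotheses (oOmega : open Omega) (bOmega : bounded_set Omega).
Hypothesis regOmega : (closure Omega)° = Omega.
Hypothesis nT : forall K, K \in T -> nondegenerate K.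
Hypothesis cT : conforming T.
Hypothesis TOmega : msupport T = closure Omega.
Hypothesis Lf : L2 Omega f.
Implicit Types (K : simplex R d) (x a : pt) (g : pt -> pt).

Let mOmega : measurable Omega := open_measurable_rV oOmega.

Let Omegaoo : (mu Omega < +oo)%E.
Proof. exact: leb_bounded. Qed.

Let Omega_msupport : Omega `<=` msupport T.
Proof. by rewrite TOmega; exact: subset_closure. Qed.

Let momega a : measurable (omega T a).
Proof. by apply: open_measurable_rV; exact: omega_open. Qed.

(** Regularity of Omega enters here: the patch is the interior of a subset of [closure Omega]. *)
Lemma omega_sub a : omega T a `<=` Omega.
Proof.
rewrite -regOmega; apply: interiorS; rewrite -TOmega => x [K + Kx].
by rewrite in_patch => /andP[KT _]; exists K.
Qed.

Lemma ae_open_simplex :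
  {ae mu, forall x, Omega x -> exists2 K, K \in T & open_simplex K x}.
Proof.
by apply: filterS (ae_msupport nT d_gt0) => x h /Omega_msupport.
Qed.

Lemma ae_all_seq (s : seq pt) (P : pt -> pt -> Prop) :
  (forall a, a \in s -> {ae mu, forall x, P a x}) ->
  {ae mu, forall x, forall a, a \in s -> P a x}.
Proof.
elim: s => [|b s IH] h; first by apply: filterE => x a.
have hb := h b (mem_head _ _).
have hs : {ae mu, forall x a, a \in s -> P a x}.
  by apply: IH => a sa; apply: h; rewrite inE sa orbT.
apply: filterS2 hb hs => x hb hs a; rewrite inE => /predU1P[->//|].
exact: hs.
Qed.

Lemma overlap (s : seq pt) (F : pt -> pt -> pt) :
  uniq s -> {subset s <= vertices T} -> (forall a, L2v (omega T a) (F a)) ->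
  nrmv Omega (fun x => \sum_(a <- s) zextv (omega T a) (F a) x) ^+ 2
  <= d.+1%:R * \sum_(a <- s) nrmv (omega T a) (F a) ^+ 2.
Proof.
move=> us sT LF.
have LzF a : L2v Omega (zextv (omega T a) (F a)) by exact/L2v_zext/LF/omega_sub.
have FN : {ae mu, forall x, Omega x ->
    (size [seq a <- s | zextv (omega T a) (F a) x != 0%R] <= d.+1)%N}.
  apply: filterS ae_open_simplex => x h Ox; have [K KT Kx] := h Ox.
  rewrite -(card_verts (nT KT)); apply: uniq_leq_size; first exact: filter_uniq.
  move=> a; rewrite mem_filter => /andP[+ /sT aT]; rewrite /zextv.
  case: ifP => [/set_mem ax _|]; last by rewrite eqxx.
  exact: (omega_open_simplex nT cT KT aT Kx ax).
apply: le_trans (overlap_sum mOmega LzF FN) _; rewrite ler_wpM2l//.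
by apply: ler_sum => a _; rewrite nrmv_zext//; exact: omega_sub.
Qed.

(** Almost every point of the patch lies in one of its open simplices. There one summand on the
    right equals the square of g, and the others are nonnegative. *)
Lemma nrmv_patch a g : a \in vertices T -> L2v (omega T a) g ->
  nrmv (omega T a) g ^+ 2 <= \sum_(K <- patch T a) nrmv (hull K)° g ^+ 2.
Proof.
move=> aT Lg; have mw := momega a.
pose h K := zextv (hull K)° g.
have Kw K : K \in patch T a -> (hull K)° `<=` (omega T a).
  by move=> KTa; apply: interiorS => x Kx; exists K.
have mK K : measurable (hull K)° by apply: open_measurable_rV; exact: open_interior.
(* Setting the function to 0 for foreign indices makes it square integrable for every index, as the
   lemmas on sums require. *)
pose h' K := if K \in patch T a then h K else fun=> 0.
have Lh K : L2v (omega T a) (h' K).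
  rewrite /h'; case: ifP => [/Kw KTa|_]; last exact: L2v_cst0.
  by apply: L2v_zext => //; apply: (L2vS (momega a) (mK K) KTa).
have -> : \sum_(K <- patch T a) nrmv (hull K)° g ^+ 2 =
    \sum_(K <- patch T a) ipv (omega T a) (h' K) (h' K).
  rewrite big_seq [RHS]big_seq; apply: eq_bigr => K KTa.
  by rewrite /h' KTa -nrmvE nrmv_zext//; exact: Kw.
have ih K : mu.-integrable (omega T a) (EFin \o (fun x => dot (h' K x) (h' K x))).
  exact: (L2v_integrable_dot (momega a) (Lh K) (Lh K)).
have -> : \sum_(K <- patch T a) ipv (omega T a) (h' K) (h' K) =
    Rintegral mu (omega T a) (fun x => \sum_(K <- patch T a) dot (h' K x) (h' K x)).
  elim: (enum_fset (patch T a)) => [|K s IH].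
    rewrite big_nil; under eq_Rintegral do rewrite big_nil.
    by rewrite Rintegral_cst ?mul0r.
  rewrite big_cons IH; under [RHS]eq_Rintegral do rewrite big_cons.
  rewrite RintegralD//.
  have := @integrable_sum _ _ _ mu _ (momega a) _ s xpredT _ (fun K _ => ih K).
  by congr (_.-integrable _ _); apply/funext => x; rewrite /= sumEFin.
rewrite nrmvE; apply: ae_le_Rintegral => //.
- exact: (L2v_integrable_dot (momega a) Lg Lg).
- have := @integrable_sum _ _ _ mu _ (momega a) _ (patch T a) xpredT _ (fun K _ => ih K).
  by congr (_.-integrable _ _); apply/funext => x; rewrite /= sumEFin.
apply: filterS ae_open_simplex => x hx wx.
have [K KT Kx] := hx (omega_sub wx).
have KTa : K \in patch T a.
  by rewrite (patch_verts nT cT)// KT (omega_open_simplex nT cT KT aT Kx wx).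
have hK : h' K x = g x.
  by rewrite /h' KTa /h /zextv mem_set// interior_hull//; exact: nT.
rewrite (big_fsetD1 K)//= hK lerDl sumr_ge0// => K' _; exact: dot_ge0.
Qed.

Lemma diam_ge0 (D : set pt) : 0 <= diam D.
Proof.
rewrite /diam; set A := [set _ | _ in _]; have [hA|nA] := pselect (has_sup A).
  have [[_ [xy Dxy _]] _] := hA.
  have /(le_trans (sqrtr_ge0 _)) := sup_ubound hA.2 (ex_intro2 _ _ xy Dxy erefl).
  exact.
by rewrite sup_out.
Qed.

(** The oscillation terms of the indicator are nonnegative and may be dropped from the larger
    side. *)
Lemma nrmv_misfit_le_eta gu sigma a : a \in vertices T ->
  L2v (omega T a) (local_misfit T gu a sigma) ->
  nrmv (omega T a) (local_misfit T gu a sigma) ^+ 2 <= eta p T Omega f gu sigma a ^+ 2.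
Proof.
move=> aT Lm; rewrite [leRHS]sqr_sqrtr; last by apply: sumr_ge0 => K _; exact: sqr_ge0.
apply: le_trans (nrmv_patch aT Lm) _; apply: ler_sum => K _.
have o0 : 0 <= diam (hull K) / pi *
    nrm (hull K)° (hat T a \* f \- L2proj p T Omega (hat T a \* f)).
  by rewrite mulr_ge0 ?nrm_ge0// divr_ge0 ?diam_ge0// pi_ge0.
by rewrite lerXn2r ?nnegrE ?addr_ge0 ?nrmv_ge0// lerDl.
Qed.

(** * Reliability: equilibrated fluxes and the Prager-Synge bound *)

Section reliability.
Hypothesis pf : pw_poly p.-1 T f.
Variables (u uh : pt -> R) (gu guh : pt -> pt) (sigma : pt -> pt -> pt).
Hypothesis wu : weak_solution Omega f u gu.
Hypothesis guhG : galerkin p T Omega f uh guh.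
Hypothesis flux : forall a, a \in vertices T -> flux_space p T Omega f guh a (sigma a).

Let Lgu : L2v Omega gu. Proof. by case: wu => -[]. Qed.
Let Lguh : L2v Omega guh. Proof. by case: guhG => -[_ []]. Qed.

Let sg a := if a \in vertices T then sigma a else fun=> 0.

Let Lsg a : L2v (omega T a) (sg a).
Proof.
rewrite /sg; case: ifP => [/flux[_ [delta [Ls _ _] _]]//|_]; exact: L2v_cst0.
Qed.

Let Lhf a : a \in vertices T -> L2 Omega (hat T a \* f).
Proof.
move=> aT; apply: L2_bounded_mul => //; first exact: hat_measurable.
by move=> x /Omega_msupport; exact: hat_bounded.
Qed.

Let phf a : a \in vertices T -> pw_poly p T (hat T a \* f).
Proof.
move=> aT; rewrite -(prednK p_gt0) -add1n; apply: pw_polyM => // K KT.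
have [q q1 qE] := wt_poly K a; exists q => // x /interior_subset Kx.
by rewrite (hatE nT cT aT KT Kx).
Qed.

Lemma hat_outside K a x : a \in vertices T -> K \in T -> open_simplex K x ->
  ~ omega T a x -> hat T a x = 0 /\ grad (hat T a) x = 0.
Proof.
move=> aT KT Kx nw; have aK : a \notin verts K.
  apply/negP => aK; apply: nw; apply: (open_patch_omega nT _ Kx).
  by rewrite (patch_verts nT cT)// KT.
have hKx := open_simplex_hull (nT KT) Kx.
rewrite (hatE nT cT aT KT hKx) wt_notin// (hat_grad nT cT aT KT Kx); split => //.
rewrite /wt_slope big_pred0// => i; apply/negbTE; apply: contra aK => /eqP <-.
exact: row_verts.
Qed.

Let tau x := \sum_(a <- vertices T) zextv (omega T a) (sg a) x.

Let Ltau : L2v Omega tau.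
Proof. by apply: L2v_sum => // a; apply: L2v_zext => //; exact: omega_sub. Qed.

(* tau has weak divergence f: the hat functions sum to 1 and their gradients
   to 0. *)
Lemma flux_equilibrated phi : test_fun Omega phi ->
  ip Omega f phi + ipv Omega tau (grad phi) = 0.
Proof.
move=> tphi; have Lphi := test_fun_L2 mOmega Omegaoo tphi.
have Lgphi := test_fun_grad_L2 mOmega Omegaoo tphi.
have /(@choice _ _ _)[delta deltaP] (a : pt) : exists delta : pt -> R, a \in vertices T ->
    Hdiv0 (omega T a) (noflux Omega T a) (sigma a) delta /\
    {ae mu, forall x, omega T a x ->
      delta x = L2proj p T Omega (hat T a \* f) x - dot (grad (hat T a) x) (guh x)}.
  have [aT|_] := boolP (a \in vertices T); last by exists (fun=> 0).
  by have [_ [delta ? ?]] := flux aT; exists delta.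
pose dl a := if a \in vertices T then delta a else fun=> 0.
have Ldl a : L2 (omega T a) (dl a).
  by rewrite /dl; case: ifP => [/deltaP[[]]//|_]; exact: L2_cst0.
have Lzdl a : L2 Omega (zext (omega T a) (dl a)) by apply: L2_zext => //; exact: omega_sub.
have fE : {ae mu, forall x, Omega x ->
    f x = \sum_(a <- vertices T) zext (omega T a) (dl a) x}.
  have h1 : {ae mu, forall x, forall a, a \in enum_fset (vertices T) ->
      omega T a x -> delta a x = L2proj p T Omega (hat T a \* f) x -
        dot (grad (hat T a) x) (guh x)}.
    by apply: ae_all_seq => a /deltaP[].
  have h2 : {ae mu, forall x, forall a, a \in enum_fset (vertices T) ->
      Omega x -> L2proj p T Omega (hat T a \* f) x = hat T a x * f x}.
    by apply: ae_all_seq => a aT; apply: L2proj_id => //; [exact: Lhf|exact: phf].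
  apply: filterS3 ae_open_simplex h1 h2 => x h0 h1 h2 Ox.
  have [K KT Kx] := h0 Ox.
  transitivity (\sum_(a <- vertices T) (hat T a x * f x - dot (grad (hat T a) x) (guh x))).
    rewrite sumrB -mulr_suml sum_hat//; last exact: Omega_msupport.
    have -> : \sum_(a <- vertices T) dot (grad (hat T a) x) (guh x) =
        dot (\sum_(a <- vertices T) grad (hat T a) x) (guh x).
      rewrite /dot exchange_big/=; apply: eq_bigr => i _.
      by rewrite summxE mulr_suml.
    rewrite (sum_hat_grad nT cT KT Kx) /dot big1; first by rewrite mul1r subr0.
    by move=> i _; rewrite mxE mul0r.
  rewrite big_seq [RHS]big_seq; apply: eq_bigr => a aT.
  rewrite /zext; case: ifPn => [/set_mem ax|/negP/[!inE] nx].
    by rewrite /dl aT h1// h2.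
  have [-> ->] := hat_outside aT KT Kx nx.
  by rewrite mul0r sub0r /dot big1 ?oppr0// => i _; rewrite mxE mul0r.
have -> : ip Omega f phi = \sum_(a <- vertices T) ip (omega T a) (dl a) phi.
  transitivity (ip Omega (fun x => \sum_(a <- vertices T) zext (omega T a) (dl a) x) phi).
    apply: ae_eq_Rintegral => //.
    - exact: L2_integrableM.
    - by apply: L2_integrableM => //; exact: L2_sum.
    - by apply: filterS fE => x fE /fE ->.
  rewrite ip_suml//; apply: eq_bigr => a _.
  by rewrite ip_zext//; exact: omega_sub.
rewrite ipv_suml//; last by move=> a; apply: L2v_zext => //; exact: omega_sub.
(* The two sums cancel patch by patch, by the integration by parts formula in [Hdiv0]. *)
rewrite -big_split big_seq; apply: big1 => a aT /=.
rewrite ipv_zext; last exact: omega_sub.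
have [[_ _ hdiv] _] := deltaP a aT.
by rewrite /dl /sg aT addrC hdiv//; exact: test_fun_noflux.
Qed.

Lemma reliability :
  nrmv Omega (gu \- guh) ^+ 2
  <= d.+1%:R * \sum_(a <- vertices T) eta p T Omega f guh (sigma a) a ^+ 2.
Proof.
have [Hu Gu] := wu; have [Fuh Guh] := guhG; have [puh Huh] := Fuh.
have e1 := H10_limit mOmega Omegaoo Lf Ltau flux_equilibrated Hu.
have e2 := H10_limit mOmega Omegaoo Lf Ltau flux_equilibrated Huh.
have e3 := Gu _ _ Hu; have e4 := Gu _ _ Huh; have e5 := Guh _ _ Fuh.
set E := gu \- guh; have LE : L2v Omega E by exact: L2vB.
have e6 : ipv Omega E E = ip Omega f u - ip Omega f uh.
  rewrite /E ipvBl// !ipvBr// e3 e4 e5 (ipvC _ guh) e4; ring.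
have LG : L2v Omega (tau \+ guh) by exact: L2vD.
(* The flux contributes -(f, u - u_l) by its equilibrium, and grad u_l is orthogonal to the error by
   Galerkin orthogonality. Cauchy-Schwarz and division by the norm of E then give [e8]. *)
have e7 : ipv Omega (tau \+ guh) E = - ipv Omega E E.
  rewrite e6 ipvDl// /E !ipvBr// e5 (ipvC _ guh) e4.
  by move: e1 e2; lra.
have e8 : nrmv Omega E ^+ 2 <= nrmv Omega (tau \+ guh) ^+ 2.
  have := ipv_CS mOmega LG LE; rewrite e7 normrN ger0_norm ?ipv_ge0// -nrmvE.
  have := nrmv_ge0 Omega E; have := nrmv_ge0 Omega (tau \+ guh).
  move: (nrmv Omega E) (nrmv Omega (tau \+ guh)) => x y y0 x0.
  have [->|xn0] := eqVneq x 0; first by rewrite expr0n sqr_ge0.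
  by rewrite expr2 ler_pM2r ?lt0r ?xn0// => xy; rewrite -expr2 lerXn2r.
apply: le_trans e8 _.
pose M a := if a \in vertices T then local_misfit T guh a (sigma a) else fun=> 0.
have LM a : L2v (omega T a) (M a).
  rewrite /M; case: ifP => aT; last exact: L2v_cst0.
  apply: L2vD; first exact: momega.
    apply: L2v_bounded_scale; first exact: momega.
    - apply: (hat_measurable nT cT aT (momega a)).
      exact: subset_trans (@omega_sub _) Omega_msupport.
    - by move=> x /omega_sub/Omega_msupport; exact: hat_bounded.
    - exact: (L2vS mOmega (momega a) (@omega_sub a)).
  by have := Lsg a; rewrite /sg aT.
(* The partition of unity distributes grad u_l over the patches, so that the sum consists of zero
   extensions of the local misfits. *)
have -> : nrmv Omega (tau \+ guh) =
    nrmv Omega (fun x => \sum_(a <- vertices T) zextv (omega T a) (M a) x).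
  have LS : L2v Omega (fun x => \sum_(a <- vertices T) zextv (omega T a) (M a) x).
    by apply: L2v_sum => // a; apply: L2v_zext => //; exact: omega_sub.
  congr Num.sqrt; apply: ae_eq_Rintegral => //.
  - exact: (L2v_integrable_dot mOmega LG LG).
  - exact: (L2v_integrable_dot mOmega LS LS).
  apply: filterS ae_open_simplex => x h0 Ox; have [K KT Kx] := h0 Ox.
  suff -> : (tau \+ guh) x = \sum_(a <- vertices T) zextv (omega T a) (M a) x by [].
  rewrite /= /tau -[X in _ + X]scale1r -(sum_hat nT cT (Omega_msupport Ox)) scaler_suml -big_split.
  rewrite big_seq [RHS]big_seq; apply: eq_bigr => a aT /=.
  rewrite /zextv; case: ifPn => [/set_mem ax|/negP/[!inE] nx].
    by rewrite /M /sg aT addrC.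
  by have [-> _] := hat_outside aT KT Kx nx; rewrite scale0r addr0.
apply: le_trans (overlap (fset_uniq _) (fun _ => id) LM) _.
rewrite ler_wpM2l// big_seq [leRHS]big_seq; apply: ler_sum => a aT.
have := LM a; rewrite /M aT; exact: nrmv_misfit_le_eta.
Qed.

End reliability.

(** * Efficiency: discrete residual liftings *)

Section efficiency.
Variables (S : mesh R d) (n : nat) (uh uh' : pt -> R) (guh guh' : pt -> pt).
Hypothesis TS : bisect n T S.
Hypothesis galT : galerkin p T Omega f uh guh.
Hypothesis galS : galerkin p S Omega f uh' guh'.

(** No element of S straddles the boundary of the patch: it lies in an element of T, whose interior
    meets [omega T a] only if that element belongs to the patch. W is kept general to allow for both
    kinds of local mesh. *)
Lemma zext_fe_space W a r gr : a \in vertices T -> finer (restr S T a) W ->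
  fe_space p W (omega T a) r gr ->
  fe_space p S Omega (zext (omega T a) r) (zextv (omega T a) gr).
Proof.
move=> aT SW [pr Hr]; split; last by apply: H10_zext => //; exact: omega_sub.
apply: (@pw_poly_extend _ _ _ _ [set K | hull K `<=` msupport (patch T a)]) => K KS Ka.
  have KSa : K \in restr S T a by rewrite !inE KS; apply/asboolP.
  have [K' K'W KK'] := SW K KSa; have [q dq qE] := pr K' K'W.
  exists q => // x Kx; rewrite /zext mem_set; last exact: interiorS Kx.
  by apply: qE; exact: interiorS Kx.
move=> x Kx; rewrite /zext memNset// => wx; apply: Ka.
have [_ ST] := bisect_sub TS nT; have [K' K'T KK'] := ST K KS.
have K'x : open_simplex K' x by rewrite -interior_hull; [exact: interiorS Kx|exact: nT].
have aK' := omega_open_simplex nT cT K'T aT K'x wx.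
by move=> y /KK' K'y; exists K' => //; rewrite (patch_verts nT cT)// K'T.
Qed.

Lemma efficiency (M : {fset pt}) (W : pt -> mesh R d) (r : pt -> pt -> R) (gr : pt -> pt -> pt) :
  {subset M <= vertices T} ->
  (forall a, a \in M -> finer (restr S T a) (W a)) ->
  (forall a, a \in M -> residual p (W a) T f guh a (r a) (gr a)) ->
  \sum_(a <- M) nrmv (omega T a) (gr a) ^+ 2 <= d.+1%:R * nrmv Omega (guh' \- guh) ^+ 2.
Proof.
move=> MT SW res.
have [[_ [_ Lguh _]] _] := galT; have [[_ [_ Lguh' _]] Guh'] := galS.
have LD : L2v Omega (guh' \- guh) by exact: L2vB.
pose F a := if a \in M then gr a else fun=> 0.
have LF a : L2v (omega T a) (F a).
  by rewrite /F; case: ifP => [/res[[_ []]]//|_]; exact: L2v_cst0.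
have LzF a : L2v Omega (zextv (omega T a) (F a)) by apply: L2v_zext => //; exact: omega_sub.
have -> : \sum_(a <- M) nrmv (omega T a) (gr a) ^+ 2 =
    \sum_(a <- M) nrmv (omega T a) (F a) ^+ 2.
  by rewrite big_seq [RHS]big_seq; apply: eq_bigr => a aM; rewrite /F aM.
have ov := overlap (fset_uniq M) MT LF.
set X := \sum_(a <- M) nrmv _ _ ^+ 2 in ov *.
set G := fun x => _ in ov.
(* The extended lifting is a test function for the Galerkin equation on S, and the lifting itself
   one for its own local equation. *)
have XE : X = ipv Omega (guh' \- guh) G.
  rewrite ipvC ipv_suml//; rewrite /X big_seq [RHS]big_seq; apply: eq_bigr => a aM.
  have [Fr Gr] := res a aM; have aT := MT a aM.
  have Fz := zext_fe_space aT (SW a aM) Fr.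
  have := LzF a; rewrite nrmvE /F aM => Lz; rewrite (Gr _ _ Fr) ipvBr//.
  rewrite (ipvC Omega _ guh') (Guh' _ _ Fz) ipv_zext; last exact: omega_sub.
  rewrite (ipC Omega) ip_zext; last exact: omega_sub.
  by rewrite (ipC _ f) (ipvC _ guh).
have LG : L2v Omega G by exact: L2v_sum.
have := ipv_CS mOmega LD LG; rewrite -XE => /(le_trans (ler_norm _)) XDG.
have X0 : 0 <= X by apply: sumr_ge0 => a _; exact: sqr_ge0.
have D0 := nrmv_ge0 Omega (guh' \- guh); have G0 := nrmv_ge0 Omega G.
(* X is at most the product of the norms of [guh' \- guh] and G, and the square of the norm of G is
   at most (d + 1) X. After squaring the first bound, one factor X cancels. *)
have [XE0|Xn0] := eqVneq X 0; first by rewrite XE0 mulr_ge0// sqr_ge0.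
rewrite -(@ler_pM2r _ X) ?lt0r ?Xn0// -expr2.
rewrite (@le_trans _ _ ((nrmv Omega (guh' \- guh) * nrmv Omega G) ^+ 2))//.
  by rewrite lerXn2r ?nnegrE// mulr_ge0.
by rewrite exprMn [leRHS]mulrAC [leRHS]mulrC ler_wpM2l// sqr_ge0.
Qed.

End efficiency.

End one_level.

(** * Contraction *)

Section run.
Variables (R : realType) (d p : nat).
Local Notation pt := 'rV[R]_d.
Variables (Omega : set pt) (f : pt -> R) (A : afem_run R d).
Implicit Types (K : simplex R d) (a : pt) (l b : nat).

(** Each pass of the loop bisects everything, which raises the generation by one, and the completing
    bisections preserve it. *)
Lemma inner_loop_mesh Cmax bmax l a :
  (forall K, K \in Tm A l -> nondegenerate K) ->
  inner_loop p Omega f A Cmax bmax l a ->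
  [/\ forall K, K \in locmesh A l a (nbis A l a) -> nondegenerate K,
      conforming (locmesh A l a (nbis A l a)) &
      forall K, K \in patch (Tm A l) a -> dissected (locmesh A l a (nbis A l a)) K (nbis A l a)].
Proof.
move=> nT [L0 /andP[n1 _] step _ _].
have nL b : (b <= nbis A l a)%N ->
    (forall K, K \in locmesh A l a b -> nondegenerate K) /\
    (forall K, K \in patch (Tm A l) a -> dissected (locmesh A l a b) K b).
  elim: b => [_|b IH bn].
    rewrite L0; split => K; last exact: dissected0.
    by rewrite in_patch => /andP[/nT].
  have [nb cb] := IH (ltnW bn); have [[m [bis _ _ _]] _] := step b bn; split.
    by have [] := bisect_sub bis (bisect_all_nondegenerate nb).
  by move=> K /cb/dissected_bisect_all; exact: (dissected_bisect bis).
have [nb cb] := nL _ (leqnn _); split => //.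
(* Conformity comes from the last pass, which exists because the loop runs at least once. *)
by move: n1 step; case: (nbis A l a) => // b _ /(_ b (ltnSn b))[[m []]].
Qed.

(** For y = 0 the finite bound excludes the value +oo, which leaves x = 0. *)
Lemma ratio_le (x y C : R) : 0 <= y -> (ratio x y <= C%:E)%E -> x <= C * y.
Proof.
rewrite /ratio le_eqVlt => /predU1P[<-|y0].
  by rewrite eqxx mulr0; case: eqP => [->|].
by rewrite (gt_eqF y0) lee_fin ler_pdivrMr.
Qed.

Lemma eta_setE (T : mesh R d) guh sigma (W : {fset pt}) :
  eta_set p T Omega f guh sigma W ^+ 2 =
  \sum_(a <- W) eta p T Omega f guh (sigma a) a ^+ 2.
Proof. by rewrite sqr_sqrtr//; apply: sumr_ge0 => a _; exact: sqr_ge0. Qed.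

(** As u_l also belongs to the finer space, all inner products other than that of [gu] with itself
    reduce to f tested with u_l or u_(l+1). *)
Lemma galerkin_pythagoras (T S : mesh R d) u gu uh guh uh' guh' :
  measurable Omega -> weak_solution Omega f u gu ->
  galerkin p T Omega f uh guh -> galerkin p S Omega f uh' guh' -> finer S T ->
  nrmv Omega (gu \- guh') ^+ 2 =
  nrmv Omega (gu \- guh) ^+ 2 - nrmv Omega (guh' \- guh) ^+ 2.
Proof.
move=> mO [Hu Gu] [[ph Hh] Gh] [[ph' Hh'] Gh'] ST.
have [_ Lgu _] := Hu; have [_ Lguh _] := Hh; have [_ Lguh' _] := Hh'.
have Sh : fe_space p S Omega uh guh by split => //; exact: pw_poly_finer ph.
have e1 := Gu _ _ Hh; have e2 := Gu _ _ Hh'; have e3 := Gh' _ _ Sh.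
have e4 := Gh' _ _ (conj ph' Hh'); have e5 := Gh _ _ (conj ph Hh).
have [L1 L2 L3] : [/\ L2v Omega (gu \- guh'), L2v Omega (gu \- guh) & L2v Omega (guh' \- guh)].
  by split; exact: L2vB.
rewrite !nrmvE !ipvBl// !ipvBr// !(ipvC _ _ gu) (ipvC _ guh guh') e1 e2 e3 e4 e5; ring.
Qed.

End run.

Lemma contraction_factor (R : realType) (d : nat) (theta C e e' dl : R) :
  0 < C ->
  theta ^+ 2 * e ^+ 2 <= d.+1%:R ^+ 2 * C ^+ 2 * dl ^+ 2 ->
  e' ^+ 2 = e ^+ 2 - dl ^+ 2 ->
  e' ^+ 2 <= (1 - theta ^+ 2 / (d.+1%:R ^+ 2 * C ^+ 2)) * e ^+ 2.
Proof.
move=> C0 h ->.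
rewrite mulrBl mul1r lerD2l lerN2 mulrAC ler_pdivrMr; first by rewrite [leRHS]mulrC.
by rewrite mulr_gt0// exprn_gt0.
Qed.

Theorem theorem3p4 (R : realType) (d p : nat)
    (Omega : set 'rV[R]_d) (f u : 'rV[R]_d -> R) (gu : 'rV[R]_d -> 'rV[R]_d)
    (T0 : mesh R d) (theta Cmax Cint : R) (bmax : nat) (A : afem_run R d)
    (rint : nat -> 'rV[R]_d -> 'rV[R]_d -> R)
    (grint : nat -> 'rV[R]_d -> 'rV[R]_d -> 'rV[R]_d) :
  (d = 2 \/ d = 3)%N ->
  (1 <= p)%N ->
  lipschitz_domain Omega ->
  L2 Omega f ->
  weak_solution Omega f u gu ->
  triangulation T0 (closure Omega) ->
  conforming T0 ->
  0 < theta <= 1 ->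
  0 < Cmax ->
  ((d = 2 -> 3 <= bmax) /\ (d = 3 -> 6 <= bmax))%N ->
  is_afem_run p Omega f A T0 theta Cmax bmax ->
  (* rint l a is r_(l+1)^a, computed on the restriction of T_(l+1) to the patch
     of a; Cint is the constant C_(lb,int)(p) *)
  (forall l a, a \in vertices (Tm A l) ->
    residual p (restr (Tm A l.+1) (Tm A l) a) (Tm A l) f (guh A l) a
      (rint l a) (grint l a)) ->
  0 < Cint ->
  (forall l a, a \in vertices (Tm A l) ->
    pw_poly p.-1 (Tm A l) f ->
    interior_node (Tm A l) (Tm A l.+1) a ->
    indicator p Omega f A l a <= Cint * nrmv (omega (Tm A l) a) (grint l a)) ->
  pw_poly p.-1 T0 f ->
  exists Clb : R,
    [/\ 0 < Clb,
        Clb <= Num.max Cmax Cint,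
        (forall l a, a \in marked A l ->
           (lb_const p Omega f A l a (nbis A l a) <= Cmax%:E)%E) ->
        Clb <= Cmax,
        (* q_ctr is the square root of a nonnegative number, except in the
           degenerate case where all errors vanish *)
        (forall l, nrmv Omega (gu \- guh A l) = 0) \/
        0 <= 1 - theta ^+ 2 / (d.+1%:R ^+ 2 * Clb ^+ 2) &
        forall l, nrmv Omega (gu \- guh A l.+1)
          <= q_ctr d theta Clb * nrmv Omega (gu \- guh A l)].
Proof.
move=> d23 p1 [oO _ _ bO lO] Lf wu [nT0 _ TO0] cT0 /andP[th0 _] Cmax0 hb
  [A0 run] hrint Cint0 hint pf0.
have d0 : (0 < d)%N by case: d23 => ->.
have regO := interior_closure_lipschitz oO lO.
have mO := open_measurable_rV oO.
have inv l : [/\ forall K, K \in Tm A l -> nondegenerate K, conforming (Tm A l),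
    msupport (Tm A l) = closure Omega & pw_poly p.-1 (Tm A l) f].
  elim: l => [|l [nT cT TO pf]]; first by rewrite A0.
  have [_ _ _ _ [n [bis cS _ _]]] := run l.
  have [nS ST] := bisect_sub bis nT; split => //; last exact: pw_poly_finer pf.
  by rewrite (bisect_msupport bis nT).
pose Q := forall l a, a \in marked A l ->
  (lb_const p Omega f A l a (nbis A l a) <= Cmax%:E)%E.
(* One constant must serve all levels, so the case distinction concerns the entire run. *)
pose Clb := if `[< Q >] then Cmax else Num.max Cmax Cint.
have Clb0 : 0 < Clb by rewrite /Clb; case: ifP => // _; rewrite lt_max Cmax0.
have CmaxClb : Cmax <= Clb by rewrite /Clb; case: ifP => // _; rewrite le_max lexx.
have main l : nrmv Omega (gu \- guh A l.+1) ^+ 2 <=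
    (1 - theta ^+ 2 / (d.+1%:R ^+ 2 * Clb ^+ 2)) * nrmv Omega (gu \- guh A l) ^+ 2.
  have [nT cT TO pf] := inv l.
  have [gal flx [[MV doe] _] inner [n [bis cS fin _]]] := run l.
  have [gal' _ _ _ _] := run l.+1.
  have [nS ST] := bisect_sub bis nT.
  have MVs : {subset marked A l <= vertices (Tm A l)} by apply/fsubsetP.
  apply: (contraction_factor Clb0 _
    (galerkin_pythagoras mO wu gal gal' ST)).
  (* Where the inner loop missed [Cmax], its lifting is replaced by the one on the restriction of
     the new mesh, the object of the bound with [Cint]. *)
  pose good a := `[< (lb_const p Omega f A l a (nbis A l a) <= Cmax%:E)%E >].
  pose W a := if good a then locmesh A l a (nbis A l a) else restr (Tm A l.+1) (Tm A l) a.
  pose r a := if good a then res A l a (nbis A l a) else rint l a.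
  pose gr a := if good a then gres A l a (nbis A l a) else grint l a.
  have SW a : a \in marked A l -> finer (restr (Tm A l.+1) (Tm A l) a) (W a).
    move=> aM; rewrite /W; case: ifP => _; first exact: fin.
    by move=> K KS; exists K.
  have resW a : a \in marked A l ->
      residual p (W a) (Tm A l) f (guh A l) a (r a) (gr a).
    move=> aM; rewrite /W /r /gr; case: ifP => _; last exact/hrint/MVs.
    have [_ /andP[n1 _] step _ _] := inner a aM.
    by move: n1 step; case: (nbis A l a) => // b _ /(_ b (ltnSn b))[].
  have etaW a : a \in marked A l -> indicator p Omega f A l a <=
      Clb * nrmv (omega (Tm A l) a) (gr a).
    move=> aM; rewrite /gr; case: ifP => [/asboolP ga|/asboolP nga].
      apply: le_trans (ratio_le (nrmv_ge0 _ _) ga) _.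
      by rewrite ler_wpM2r// nrmv_ge0.
    have -> : Clb = Num.max Cmax Cint.
      by rewrite /Clb ifF//; apply/negP => /asboolP/(_ l a aM).
    have aT := MVs a aM.
    apply: le_trans (hint l a aT pf _) _; last first.
      by rewrite ler_wpM2r ?nrmv_ge0// le_max lexx orbT.
    have [nU cU cutU] := inner_loop_mesh nT (inner a aM).
    have nb : nbis A l a = bmax by have [_ _ _ _ []] := inner a aM.
    have [k [hk kb]] : exists k, interior_supports d k /\ (k <= bmax)%N.
      case: d23 hb => -> [h2 h3].
        by exists 3; split; [exact: interior_supports2|exact: h2].
      by exists 6; split; [exact: interior_supports3|exact: h3].
    apply: (interior_nodes hk nT bis nU cU (fin a aM)) => K /cutU.
    by apply: dissected_leq; rewrite nb.
  have eff := efficiency d0 oO regO nT cT TO bis gal gal' MVs SW resW.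
  have rel := reliability d0 p1 oO bO regO nT cT TO Lf pf wu gal
    (fun a aT => (flx a aT).1).
  have : (theta * estimator p Omega f A l (vertices (Tm A l))) ^+ 2 <=
      estimator p Omega f A l (marked A l) ^+ 2.
    by rewrite lerXn2r ?nnegrE ?mulr_ge0 ?sqrtr_ge0// ltW.
  rewrite exprMn !eta_setE => doe2.
  have effM : \sum_(a <- marked A l) indicator p Omega f A l a ^+ 2 <=
      Clb ^+ 2 * \sum_(a <- marked A l) nrmv (omega (Tm A l) a) (gr a) ^+ 2.
    rewrite mulr_sumr big_seq [leRHS]big_seq; apply: ler_sum => a aM.
    rewrite -exprMn lerXn2r ?nnegrE ?sqrtr_ge0 ?etaW//.
    by rewrite mulr_ge0 ?nrmv_ge0// ltW.
  set X := \sum_(a <- marked A l) _ in eff effM.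
  set Y := \sum_(a <- vertices _) _ in doe2 rel.
  set Z := \sum_(a <- marked A l) _ in doe2 effM.
  have dd0 : 0 <= d.+1%:R :> R by [].
  (* The chain is reliability, marking, the local bounds [etaW], and efficiency; the first and the
     last each contribute one factor d + 1. *)
  apply: le_trans (ler_wpM2l (sqr_ge0 theta) rel) _.
  rewrite mulrCA; apply: le_trans (ler_wpM2l dd0 (le_trans doe2 effM)) _.
  rewrite [leRHS](_ : _ = d.+1%:R * (Clb ^+ 2 *
    (d.+1%:R * nrmv Omega (guh A l.+1 \- guh A l) ^+ 2))); last by ring.
  by rewrite ler_wpM2l// ler_wpM2l// sqr_ge0.
exists Clb; split => //.
- by rewrite /Clb; case: ifP => // _; rewrite le_max lexx.
- by move=> q; rewrite /Clb ifT//; apply/asboolP.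
- have [q0|q0] := leP 0 (1 - theta ^+ 2 / (d.+1%:R ^+ 2 * Clb ^+ 2)); first by right.
  (* With a negative factor, [main] bounds a square by a negative multiple of a square, so each
     error is 0. *)
  left => l; have := le_trans (sqr_ge0 _) (main l).
  by rewrite nmulr_rge0// => e0; apply/eqP; rewrite -sqrf_eq0 eq_le e0 sqr_ge0.
- move=> l; rewrite -(@ler_pXn2r _ 2) ?nnegrE ?mulr_ge0 ?sqrtr_ge0//.
  rewrite exprMn /q_ctr.
  have [q0|q0] := leP 0 (1 - theta ^+ 2 / (d.+1%:R ^+ 2 * Clb ^+ 2)).
    by rewrite [X in _ <= X * _]sqr_sqrtr//; exact: main.
  (* Here [q_ctr] takes the default value 0 of the square root, and the right-hand side of [main] is
     nonpositive. *)
  by rewrite ltr0_sqrtr// expr0n mul0r; apply: le_trans (main l) _; rewrite mulr_le0_ge0 ?sqr_ge0// ltW.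
Qed.
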